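(* Fix a positive integer $k\ge3$. There exists a constant $c_k>0$ such that the following holds. Let $A\subset\mathbb{Z}$ be a subset with $|A|=n$, or let $A\subset\mathbb{Z}/N\mathbb{Z}$ with $N$ prime and $|A|=n\le c_kN$. Then $T_k(A)\le T_k([n])$, where $[n]=\{1,\dots,n\}$ is regarded as a subset of $\mathbb{Z}$.
   Context: For a finite subset $A$ of an abelian group $G$ (here $G=\mathbb{Z}$ or $G=\mathbb{Z}/N\mathbb{Z}$), $T_k(A)$ is the number of pairs $(a,b)\in G\times G$ with $a,a+b,a+2b,\dots,a+(k-1)b\in A$. Thus $b=0$ is allowed, and both $b$ and $-b$ are counted. *)

(* Defs.v *)
From mathcomp Require Import all_boot all_order all_algebra.
From mathcomp Require Import finmap.
From mathcomp Require Import boolp classical_sets functions cardinality.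

Set Implicit Arguments.
Unset Strict Implicit.
Unset Printing Implicit Defensive.

Import GRing.Theory.
Local Open Scope classical_set_scope.
Local Open Scope ring_scope.

Definition kAP (G : zmodType) (k : nat) (A : {fset G}) : set (G * G) :=
  [set p | forall i : nat, (i < k)%N -> p.1 + p.2 *+ i \in A].

(* The count T_k(A). [fset_set] is only meaningful on finite sets; see [finite_kAP]. *)
Definition numAP (G : zmodType) (k : nat) (A : {fset G}) : nat :=
  (#|` fset_set (kAP k A)|)%fset.

Definition zinterval (n : nat) : {fset int} :=
  [fset Posz i | i in iota 1 n]%fset.

Lemma finite_kAP (G : zmodType) (k : nat) (A : {fset G}) :
  (1 < k)%N -> finite_set (kAP k A).
Proof.
move=> k1.
apply: (@sub_finite_set _ _
  ((fun p : G * G => (p.1, p.2 - p.1)) @` ([set` A] `*` [set` A]))).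
  move=> [a b] /= AP; exists (a, a + b) => /=.
    split=> /=; first by have := AP 0%N (ltnW k1); rewrite mulr0n addr0.
    by have := AP 1%N k1; rewrite mulr1n.
  by rewrite addrAC subrr add0r.
by apply: finite_image; apply: finite_setX; exact: finite_fset.
Qed.

Lemma card_zinterval (n : nat) : (#|` zinterval n|)%fset = n.
Proof.
rewrite card_imfset /=; last by move=> i j [].
by rewrite undup_id ?iota_uniq // size_iota.
Qed.

(* Main.v *)
Require Import Defs.
From mathcomp Require Import all_boot all_order all_algebra.
From mathcomp Require Import finmap.
From mathcomp Require Import boolp classical_sets functions cardinality reals.
From mathcomp Require Import trigo ring lra zify.
From mathcomp Require Import fintype finset.

Set Implicit Arguments.
Unset Strict Implicit.
Unset Printing Implicit Defensive.

Import Order.TTheory GRing.Theory Num.Theory.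
Local Open Scope ring_scope.

(** The integer case. Number [A] by a bijection onto [0, n[ along which the residue mod [q = k
    - 1] is nondecreasing. Along a progression the residues form a monotone map [{0, ..., q}
    -> {0, ..., q - 1}], which therefore takes the value [i] at both [i] and [i + 1] for some
    [i]; recording the numbers of the terms [i] and [i + 1] injects the progressions of [A]
    into the pairs of [0, n[ congruent mod [q], i.e. into the progressions of [n].

    The case of Z/N, by induction on [n]. If [A] has more progressions than [n], then every
    cut of [A] is crossed by many 3-term progressions. From their number alone, a weak Balog-
    Szemeredi-Gowers argument followed by Croot-Sisask sampling gives a positive proportion of
    [A] inside a translate of a ball of almost-periods; covering shows that the iterated sums
    of this ball grow polynomially, so one of them is almost invariant, and its Fourier mass
    away from 0 produces a dilate for which that part of [A] lies in an arbitrarily short arc.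
    Since no cut is sparse, reflections of the part already in the arc capture a fixed
    proportion of what is left, and Dirichlet's theorem brings the new arc onto the old one;
    finitely many rounds put a dilate of [A] in an arc of length less than [N / 2], where
    progressions lift to the integers. *)

(** * Popular differences *)

Ltac pos := repeat first [assumption | exact: ltr0Sn | exact: ltr01 | apply: mulr_gt0 | apply: exprn_gt0
  | rewrite invr_gt0 | apply: addr_gt0].

Lemma exists_ge_sum (R : realDomainType) (I : finType) (A : {set I}) (F H : I -> R) :
  (0 < #|A|)%N -> \sum_(i in A) F i <= \sum_(i in A) H i ->
  exists2 i, i \in A & F i <= H i.
Proof.
move=> /card_gt0P[i0 i0A] le_FH; apply/exists_inP/contraT.
rewrite negb_exists_in => /forall_inP lt_HF.
suff: \sum_(i in A) H i < \sum_(i in A) F i by rewrite ltNge le_FH.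
apply: ltr_sum; last by move=> i /lt_HF; rewrite -ltNge.
by apply/hasP; exists i0; rewrite ?mem_index_enum.
Qed.

Lemma sum_sqr_ge (R : realFieldType) (I : finType) (A : {set I}) (F : I -> R) :
  (\sum_(i in A) F i) ^+ 2 <= #|A|%:R * \sum_(i in A) F i ^+ 2.
Proof.
set S := \sum_(i in A) F i; set Q := \sum_(i in A) F i ^+ 2.
have : 0 <= \sum_(i in A) (#|A|%:R * F i - S) ^+ 2 by apply: sumr_ge0 => i _; exact: sqr_ge0.
have -> : \sum_(i in A) (#|A|%:R * F i - S) ^+ 2 = #|A|%:R * (#|A|%:R * Q - S ^+ 2).
  rewrite (eq_bigr (fun i => #|A|%:R ^+ 2 * F i ^+ 2 - (2 * #|A|%:R * S) * F i + S ^+ 2)).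
    by rewrite !big_split /= sumrN -!mulr_sumr sumr_const -[_ *+ #|A|]mulr_natr -/S -/Q; ring.
  by move=> i _; ring.
have [A0|A0] := posnP #|A|; last by rewrite pmulr_rge0 ?ltr0n // subr_ge0.
by rewrite /S /Q (cards0_eq A0) !big_set0 expr0n mulr0.
Qed.

(** Used as a graph on [A]: adjacent points are the ends of a 3-term progression centred in [A]. *)
Definition ends3 (G : finZmodType) (A : {set G}) (x y : G) : bool :=
  [exists w in A, x + y == w + w].

Lemma sum_card (R : pzSemiRingType) (I : finType) (A B : {pred I}) :
  \sum_(i in A) (i \in B)%:R = #|[pred i in A | i \in B]|%:R :> R.
Proof.
rewrite -sum1_card natr_sum [RHS]big_mkcond [LHS]big_mkcond /=.
by apply: eq_bigr => i _; rewrite !inE; case: (i \in A); case: (i \in B).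
Qed.

(* Weak Balog-Szemeredi-Gowers: [A'] is the neighbourhood, in the graph [ends3], of a well chosen vertex. *)
Lemma dense_popular (R : realFieldType) (G : finZmodType) (A : {set G}) (D th : R) :
  0 < D -> 0 < th -> (0 < #|A|)%N ->
  #|A|%:R ^+ 2 <= D * \sum_(x in A) \sum_(y in A) (ends3 A x y)%:R ->
  exists A' P : {set G},
    [/\ A' \subset A, #|A|%:R <= 2 * D ^+ 2 * #|A'|%:R,
        #|A|%:R ^+ 2 <= 2 * D ^+ 2 * \sum_(x in A') \sum_(y in A) (ends3 A x y)%:R,
        \sum_(x in A') \sum_(y in A') (x - y \notin P)%:R <= th * #|A'|%:R ^+ 2
      & th * #|P|%:R <= 4 * D ^+ 4 * #|A|%:R].
Proof.
move=> D0 th0 A0 hE; set n : R := #|A|%:R.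
have n0 : 0 < n by rewrite ltr0n.
pose ka : R := th / (4 * D ^+ 4).
have ka0 : 0 < ka by rewrite divr_gt0 // mulr_gt0 // exprn_gt0.
pose E x y : R := (ends3 A x y)%:R.
have E_ge0 x y : 0 <= E x y by rewrite ler0n.
have E_le1 x y : E x y <= 1 by rewrite lern1 leq_b1.
pose deg x := \sum_(y in A) E x y.
pose cod x y := \sum_(v in A) E x v * E y v.
pose e v := \sum_(x in A) E x v * deg x.
pose bad v := \sum_(x in A) \sum_(y in A) E x v * E y v * (cod x y < ka * n)%R%:R.
have sumdeg2 : n ^+ 3 <= D ^+ 2 * \sum_(x in A) deg x ^+ 2.
  have := sum_sqr_ge A deg; rewrite -/n => cs.
  have S0 : 0 <= \sum_(x in A) deg x by do 2![apply: sumr_ge0 => ? _].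
  rewrite -(ler_pM2l n0) -exprS.
  have -> : n ^+ 4 = (n ^+ 2) ^+ 2 by ring.
  apply: (@le_trans _ _ ((D * \sum_(x in A) deg x) ^+ 2)); first by rewrite ler_sqr ?nnegrE ?mulr_ge0 ?sqr_ge0 // ltW.
  by rewrite exprMn [leRHS]mulrCA ler_pM2l // exprn_gt0.
have sume : \sum_(v in A) e v = \sum_(x in A) deg x ^+ 2.
  by rewrite exchange_big /=; apply: eq_bigr => x _; rewrite -mulr_suml -expr2.
have sumbad : \sum_(v in A) bad v <= ka * n ^+ 3.
  have -> : \sum_(v in A) bad v = \sum_(x in A) \sum_(y in A) cod x y * (cod x y < ka * n)%R%:R.
    rewrite exchange_big /=; apply: eq_bigr => x _.
    by rewrite exchange_big /=; apply: eq_bigr => y _; rewrite -mulr_suml.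
  have -> : ka * n ^+ 3 = \sum_(x in A) \sum_(y in A) ka * n.
    by rewrite !sumr_const -mulrnA -mulr_natr natrM -/n; ring.
  apply: ler_sum => x _; apply: ler_sum => y _.
  case: ltP => [/ltW|_]; first by rewrite mulr1.
  by rewrite mulr0 mulr_ge0 // ltW.
(* Summed over [v], the left side is at most [2 * n ^+ 3] by [sumbad], the right side at least that
   by [sumdeg2]. One [v] thus has few bad pairs and many edges leaving its neighbourhood. *)
have [v vA hv] : exists2 v, v \in A & n ^+ 2 + bad v / ka <= 2 * D ^+ 2 * e v.
  apply: exists_ge_sum => //.
  have -> : \sum_(v in A) (n ^+ 2 + bad v / ka) = n ^+ 2 * n + (\sum_(v in A) bad v) / ka.
    by rewrite big_split mulr_suml /= sumr_const mulr_natr.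
  rewrite -mulr_sumr sume.
  have : (\sum_(v in A) bad v) / ka <= n ^+ 3 by rewrite ler_pdivrMr // mulrC.
  have -> : n ^+ 2 * n = n ^+ 3 by ring.
  by move: sumdeg2; set X := _ / ka; set Y := D ^+ 2; set Z := \sum_(x in A) _; lra.
pose A' := [set x in A | ends3 A x v].
have EA' (F : G -> R) : \sum_(x in A') F x = \sum_(x in A) E x v * F x.
  rewrite big_mkcond [RHS]big_mkcond /=; apply: eq_bigr => x _; rewrite inE /E.
  by case: (x \in A); case: (ends3 A x v); rewrite ?mul1r ?mul0r.
have bad0 : 0 <= bad v by do 2![apply: sumr_ge0 => ? _]; rewrite !mulr_ge0.
have e_le : e v <= n * #|A'|%:R.
  have -> : n * #|A'|%:R = \sum_(x in A') n by rewrite sumr_const mulr_natr.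
  rewrite EA'; apply: ler_sum => x _; rewrite ler_wpM2l //.
  have -> : n = \sum_(y in A) 1 by rewrite sumr_const.
  exact: ler_sum.
have badka : 0 <= bad v / ka by rewrite divr_ge0 // ltW.
have hA' : n <= 2 * D ^+ 2 * #|A'|%:R.
  have D2 : 0 <= 2 * D ^+ 2 by rewrite mulr_ge0 // exprn_ge0 // ltW.
  rewrite -(ler_pM2l n0) -expr2 mulrCA.
  apply: le_trans (ler_wpM2l D2 e_le); apply: le_trans hv; lra.
(* A common neighbour [w] of [x] and [y] gives [x + w = a + a] and [y + w = b + b], so it represents
   [x - y] in the form counted here; distinct [w] give distinct [a]. *)
pose P := [set d | ka * n <= #|[set p in setX A A | (p.1 + p.1) - (p.2 + p.2) == d]|%:R].
exists A', P; split => //.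
- by apply/subsetP => x; rewrite inE => /andP[].
- by rewrite EA'; apply: le_trans hv; rewrite lerDl.
- have -> : \sum_(x in A') \sum_(y in A') (x - y \notin P)%:R
     = \sum_(x in A) \sum_(y in A) E x v * E y v * (x - y \notin P)%:R :> R.
    rewrite EA'; apply: eq_bigr => x _; rewrite EA' mulr_sumr.
    by apply: eq_bigr => y _; rewrite mulrA.
  apply: (@le_trans _ _ (bad v)).
    apply: ler_sum => x xA; apply: ler_sum => y yA; rewrite ler_wpM2l ?mulr_ge0 //.
    rewrite ler_nat inE -ltNge; case: (ltP (cod x y)) => [_|le2]; first exact: leq_b1.
    case: ltP => // lt1; exfalso; move: (lt_le_trans lt1 le2); rewrite ltNge; apply/negP; rewrite negbK.
    have -> : cod x y = \sum_(w in A) (w \in [pred u | ends3 A x u && ends3 A y u])%:R.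
      by apply: eq_bigr => w _; rewrite /E !inE -natrM mulnb.
    rewrite sum_card ler_nat; set S := [set p in _ | _].
    apply: leq_trans (leq_imset_card (fun p => p.1 + p.1 - x) S).
    apply: subset_leq_card; apply/subsetP => w; rewrite !inE => /and3P[_].
    move=> /exists_inP[a aA /eqP xa] /exists_inP[b bA /eqP yb].
    apply/imsetP; exists (a, b) => /=; last by rewrite -xa addrC addKr.
    by rewrite !inE aA bA /= -xa -yb opprD addrACA subrr addr0.
  have D0' : D != 0 by rewrite gt_eqF.
  have e1 : bad v <= ka * (2 * D ^+ 2 * (n * #|A'|%:R)).
    rewrite mulrC -ler_pdivrMr //; apply: le_trans (_ : 2 * D ^+ 2 * e v <= _).
      by apply: le_trans hv; rewrite lerDr sqr_ge0.
    by rewrite ler_pM2l // mulr_gt0 // exprn_gt0.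
  apply: le_trans e1 _.
  have -> : th = 4 * D ^+ 4 * ka by rewrite /ka; field.
  apply: le_trans (_ : ka * (2 * D ^+ 2 * (2 * D ^+ 2 * #|A'|%:R * #|A'|%:R)) <= _).
    by rewrite ler_pM2l // ler_pM2l ?ler_wpM2r // mulr_gt0 // exprn_gt0.
  by rewrite [leLHS](_ : _ = 4 * D ^+ 4 * ka * #|A'|%:R ^+ 2) //; ring.
- have D0' : D != 0 by rewrite gt_eqF.
  have -> : th = 4 * D ^+ 4 * ka by rewrite /ka; field.
  have D4 : 0 < 4 * D ^+ 4 by rewrite mulr_gt0 // exprn_gt0.
  rewrite -mulrA ler_pM2l // -(ler_pM2r n0) -expr2 mulrAC.
  have -> : ka * n * #|P|%:R = \sum_(d in P) ka * n by rewrite sumr_const mulr_natr.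
  pose r (p : G * G) := p.1 + p.1 - (p.2 + p.2).
  apply: (@le_trans _ _ (\sum_d #|[set p in setX A A | r p == d]|%:R)).
    rewrite big_mkcond /=; apply: ler_sum => d _; case: ifP; rewrite ?ler0n //.
    by rewrite inE.
  rewrite -natr_sum -natrX -mulnn -cardsX ler_nat -sum1_card.
  rewrite (partition_big r predT) //=; apply: leq_sum => d _.
  by rewrite sum1dep_card; apply/subset_leq_card/subsetP => p; rewrite !inE.
Qed.

(** * Croot-Sisask sampling *)

Section Sampling.
Variables (R : realFieldType) (T : finType) (A : {set T}) (s : nat).
Implicit Types (i j : 'I_s) (F : T -> R).

Lemma sum_ffun_on1 F i :
  \sum_(x in @ffun_on 'I_s A) F (x i) = #|A|%:R ^+ s.-1 * \sum_(a in A) F a.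
Proof.
pose H (l : 'I_s) a := if l == i then F a else 1.
transitivity (\sum_(x in @ffun_on 'I_s A) \prod_l H l (x l)).
  apply: eq_bigr => x _; rewrite (bigD1 i) //= big1 ?mulr1 /H ?eqxx // => l /negPf->//.
rewrite -(bigA_distr_big [in A] H) (bigD1 i) //= mulrC; congr (_ * _); last first.
  by apply: eq_bigr => a _; rewrite /H eqxx.
rewrite (eq_bigr (fun=> #|A|%:R)); last first.
  by move=> l /negPf li; rewrite (eq_bigr (fun=> 1)) ?sumr_const // /H li.
by rewrite prodr_const (eq_card (_ : _ =i predC1 i)) // cardC1 card_ord.
Qed.

Lemma sum_ffun_on2 F i j : i != j -> \sum_(a in A) F a = 0 ->
  \sum_(x in @ffun_on 'I_s A) F (x i) * F (x j) = 0.
Proof.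
move=> ij F0.
pose H (l : 'I_s) a := (if l == i then F a else 1) * (if l == j then F a else 1).
transitivity (\sum_(x in @ffun_on 'I_s A) \prod_l H l (x l)).
  apply: eq_bigr => x _; rewrite big_split /= (bigD1 i) //= big1 => [|l /negPf->//].
  by rewrite (bigD1 j) //= big1 => [|l /negPf->//]; rewrite !eqxx !mulr1.
rewrite -(bigA_distr_big [in A] H) (bigD1 i) //= [X in X * _](_ : _ = 0) ?mul0r //.
rewrite -[RHS]F0; apply: eq_bigr => a _; by rewrite /H eqxx (negPf ij) mulr1.
Qed.

(** The coordinates of a random tuple are independent, so cross terms vanish when [F] has sum 0 and
    only the diagonal survives. *)
Lemma sampling_variance F : \sum_(a in A) F a = 0 ->
  \sum_(x in @ffun_on 'I_s A) (\sum_(i < s) F (x i)) ^+ 2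
    = s%:R * #|A|%:R ^+ s.-1 * \sum_(a in A) F a ^+ 2.
Proof.
move=> F0.
transitivity (\sum_i \sum_j \sum_(x in @ffun_on 'I_s A) F (x i) * F (x j)).
  rewrite [RHS](eq_bigr (fun i => \sum_(x in @ffun_on 'I_s A) \sum_j F (x i) * F (x j))).
    rewrite [RHS]exchange_big /=; apply: eq_bigr => x _.
    by rewrite expr2 mulr_suml; apply: eq_bigr => i _; rewrite mulr_sumr.
  by move=> i _; rewrite exchange_big.
rewrite (eq_bigr (fun=> #|A|%:R ^+ s.-1 * \sum_(a in A) F a ^+ 2)).
  by rewrite sumr_const card_ord -mulrA mulr_natl.
move=> i _; rewrite (bigD1 i) //= [X in _ + X]big1 ?addr0 => [|j ji]; last first.
  by rewrite sum_ffun_on2 // eq_sym.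
rewrite -(sum_ffun_on1 (fun a => F a ^+ 2) i).
by apply: eq_bigr => x _; rewrite expr2.
Qed.

End Sampling.

(** The convolution of the indicators of [X] and [W]. *)
Definition conv (R : realFieldType) (G : finZmodType) (X W : {set G}) (y : G) : R :=
  \sum_(x in X) (y - x \in W)%:R.

Section Conv.
Variables (R : realFieldType) (G : finZmodType) (X W : {set G}).
Local Notation f := (conv R X W).

Lemma sum_setsub (x : G) : \sum_y (y - x \in W)%:R = #|W|%:R :> R.
Proof.
rewrite -sum1_card natr_sum [RHS]big_mkcond (reindex_inj (addIr x)) /=.
by apply: eq_bigr => y _; rewrite addrK; case: (y \in W).
Qed.

Lemma conv_ge0 y : 0 <= f y.
Proof. by apply: sumr_ge0. Qed.

Lemma sum_conv : \sum_y f y = #|X|%:R * #|W|%:R.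
Proof.
rewrite exchange_big /= (eq_bigr (fun=> #|W|%:R)) ?sumr_const ?mulr_natl //.
by move=> x _; exact: sum_setsub.
Qed.

Let phi y u : R := #|X|%:R * (y - u \in W)%:R - f y.

Lemma sum_dev y : \sum_(u in X) phi y u = 0.
Proof.
by rewrite sumrB -mulr_sumr sumr_const -/(f y) mulr_natl subrr.
Qed.

Lemma sum_dev2 y : \sum_(u in X) phi y u ^+ 2 <= #|X|%:R ^+ 2 * f y.
Proof.
rewrite (eq_bigr (fun u => (#|X|%:R ^+ 2 - 2 * #|X|%:R * f y) * (y - u \in W)%:R + f y ^+ 2)).
  rewrite big_split /= -mulr_sumr sumr_const -[_ *+ #|X|]mulr_natl -/(f y).
  have := mulr_ge0 (ler0n R #|X|) (sqr_ge0 (f y)); lra.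
by move=> u _; rewrite /phi; case: (y - u \in W); rewrite /=; ring.
Qed.

(** The sum of [s] random translates of the indicator of [W] approximates [s / #|X|] times the
    convolution in mean square; the denominator is cleared. *)
Lemma conv_sampling s :
  \sum_(x in @ffun_on 'I_s X)
     \sum_y (#|X|%:R * \sum_(i < s) (y - x i \in W)%:R - s%:R * f y) ^+ 2
    <= s%:R * #|X|%:R ^+ s.-1 * (#|X|%:R ^+ 2 * (#|X|%:R * #|W|%:R)).
Proof.
rewrite exchange_big /= -sum_conv mulr_sumr mulr_sumr; apply: ler_sum => y _.
apply: le_trans (_ : s%:R * #|X|%:R ^+ s.-1 * \sum_(u in X) phi y u ^+ 2 <= _); last first.
  by rewrite ler_wpM2l ?sum_dev2 // mulr_ge0 // exprn_ge0.
rewrite -sampling_variance ?sum_dev // le_eqVlt; apply/predU1l/eq_bigr => x _.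
by rewrite sumrB -mulr_sumr sumr_const card_ord [s%:R * _]mulr_natl.
Qed.
End Conv.

Definition sqdist (R : realFieldType) (G : finZmodType) (f : G -> R) (b c : G) : R :=
  \sum_y (f (y + b) - f (y + c)) ^+ 2.

(** For many pairs [(t, x)] the tuple [x] samples [f] well and all [x i - t] lie in [P]. Since [P]
    is small, one tuple [z] serves as [x - t] for many [t]; the translates of [f] by these [t] are
    all close to the function sampled by [z], hence to each other. *)
Lemma almost_periods (R : realFieldType) (D : nat) : (0 < D)%N ->
  exists2 d : R, 0 < d & forall (G : finZmodType) (A : {set G}),
  (0 < #|A|)%N ->
  #|A|%:R ^+ 2 <= D%:R * \sum_(x in A) \sum_(y in A) (ends3 A x y)%:R :> R ->
  exists (T : {set G}) (f : G -> R),
    [/\ T \subset A, d * #|A|%:R <= #|T|%:R,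
        \sum_y f y <= #|A|%:R ^+ 2 /\ (forall y, 0 <= f y),
        #|A|%:R ^+ 3 <= 4 * D%:R ^+ 4 * \sum_y f y ^+ 2
      & {in T &, forall t t', 16 * sqdist f t t' <= \sum_y f y ^+ 2}].
Proof.
move=> D0; have D0R : 0 < D%:R :> R by rewrite ltr0n.
(* With the lower bound [F2_ge], this size makes at most a quarter of the samples bad in [hgood]. *)
pose s := (1024 * D ^ 4)%N.
have s0 : (0 < s)%N by rewrite muln_gt0 expn_gt0 D0.
have s0R : 0 < s%:R :> R by rewrite ltr0n.
(* In [hpairs], a union bound over the [s] coordinates then loses at most another quarter. *)
pose th : R := (4 * s%:R)^-1.
have th0 : 0 < th by rewrite invr_gt0 mulr_gt0.
pose C : R := 4 * D%:R ^+ 4 / th.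
have C0 : 0 < C by rewrite divr_gt0 // mulr_gt0 // exprn_gt0.
pose E := 2 * (2 * C * D%:R ^+ 2) ^+ s * (2 * D%:R ^+ 2).
have E0 : 0 < E by rewrite /E; pos.
exists E^-1 => [|G A A0 hE]; first by rewrite invr_gt0.
have [A' [P [sA'A nA' he hbad hP]]] := dense_popular D0R th0 A0 hE.
set n : R := #|A|%:R in nA' he hP *; set a : R := #|A'|%:R in nA' hbad.
have n0 : 0 < n by rewrite ltr0n.
have a0 : 0 < a.
  rewrite lt_def ler0n andbT; apply: contraTneq (nA') => ->.
  by rewrite mulr0 -ltNge.
pose f := conv R A' A; pose F2 := \sum_y f y ^+ 2.
have an : a <= n by rewrite ler_nat subset_leq_card.
(* An adjacent pair sums to a double [w + w], and there are at most [n] doubles. So [f] has a large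
   sum on a small set, and Cauchy-Schwarz bounds [F2] from below. *)
have F2_ge : n ^+ 3 <= 4 * D%:R ^+ 4 * F2.
  pose dA := [set w + w | w in A].
  have le_e : \sum_(x in A') \sum_(y in A) (ends3 A x y)%:R <= \sum_(y in dA) f y.
    rewrite [leRHS]exchange_big /=; apply: ler_sum => x _.
    rewrite [leLHS]big_mkcond [leRHS]big_mkcond [leRHS](reindex_inj (addrI x)) /=.
    apply: ler_sum => y _; rewrite addrAC subrr add0r; case: (y \in A) => /=; last by case: ifP.
    rewrite /ends3; case: exists_inP => [[w wA /eqP xyw]|_] /=; last by case: ifP.
    by rewrite ifT // xyw; apply/imsetP; exists w.
  have S0 : 0 <= \sum_(y in dA) f y by apply: sumr_ge0 => y _; exact: conv_ge0.
  have h1 : n ^+ 2 <= 2 * D%:R ^+ 2 * \sum_(y in dA) f y.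
    by apply: le_trans he _; rewrite ler_wpM2l // ltW //; pos.
  have h2 : (\sum_(y in dA) f y) ^+ 2 <= n * F2.
    apply: le_trans (sum_sqr_ge _ _) _; apply: ler_pM => //.
    - by apply: sumr_ge0 => y _; exact: sqr_ge0.
    - by rewrite ler_nat leq_imset_card.
    - by rewrite big_mkcond /=; apply: ler_sum => y _; case: ifP => // _; exact: sqr_ge0.
  rewrite -(ler_pM2l n0) -exprS.
  apply: le_trans (_ : (2 * D%:R ^+ 2 * \sum_(y in dA) f y) ^+ 2 <= _).
    rewrite [leLHS](_ : _ = (n ^+ 2) ^+ 2); last by rewrite -exprM.
    by rewrite lerXn2r ?nnegrE ?exprn_ge0 // ?(ltW n0) // mulr_ge0 // ltW //; pos.
  rewrite exprMn [leRHS]mulrCA (_ : (2 * D%:R ^+ 2) ^+ 2 = 4 * D%:R ^+ 4); last by ring.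
  by rewrite ler_wpM2l // ltW //; pos.
have V := conv_sampling R A' A s; rewrite -/a -/n in V.
(* After division by [s%:R ^+ 2], two such errors combine to a square distance of at most
   [F2 / 16]. *)
pose good (x : {ffun 'I_s -> G}) :=
  \sum_y (a * \sum_i (y - x i \in A)%:R - s%:R * f y) ^+ 2 <= s%:R ^+ 2 * F2 / 64.
have F20 : 0 < F2.
  have := lt_le_trans (exprn_gt0 3 n0) F2_ge.
  by rewrite pmulr_rgt0 //; pos.
have hgood : \sum_(x in @ffun_on 'I_s A') (~~ good x)%:R <= a ^+ s / 4.
  set B := leLHS.
  have B1 : B * (s%:R ^+ 2 * F2 / 64) <= s%:R * a ^+ s.-1 * (a ^+ 2 * (a * n)).
    apply: le_trans V; rewrite mulr_suml; apply: ler_sum => x _.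
    rewrite /good -ltNge; case: ltP => [/ltW|_]; rewrite ?mul1r // mul0r.
    by apply: sumr_ge0 => y _; exact: sqr_ge0.
  have sE : s%:R = 1024 * D%:R ^+ 4 :> R by rewrite natrM natrX.
  have aE : a ^+ s = a * a ^+ s.-1 by rewrite -exprS prednK.
  have B0 : 0 <= B by apply: sumr_ge0.
  have as0 : 0 < a ^+ s.-1 by exact: exprn_gt0.
  have D4 : 0 < D%:R ^+ 4 :> R by exact: exprn_gt0.
  have B2 : B * (s%:R * F2) <= 64 * (a ^+ s * (a ^+ 2 * n)).
    have s64 : 0 < s%:R / 64 :> R by pos.
    rewrite -(ler_pM2l s64) aE; move: B1; lra.
  have B3 : B * (s%:R * n ^+ 3) <= 4 * D%:R ^+ 4 * (64 * (a ^+ s * (a ^+ 2 * n))).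
    apply: (@le_trans _ _ (B * (s%:R * (4 * D%:R ^+ 4 * F2)))).
      by do 2![rewrite ler_wpM2l // ?(ltW s0R)].
    have h4 : 0 < 4 * D%:R ^+ 4 :> R by pos.
    by move: B2; rewrite -(ler_pM2l h4); lra.
  have B4 : B * 4 * n ^+ 3 <= a ^+ s * (a ^+ 2 * n).
    have h4 : 0 < 256 * D%:R ^+ 4 :> R by pos.
    by rewrite -(ler_pM2l h4); move: B3; rewrite sE; lra.
  have B5 : a ^+ 2 * n <= n ^+ 3.
    by rewrite [leRHS]exprSr ler_wpM2r ?(ltW n0) // lerXn2r // nnegrE ltW.
  rewrite ler_pdivlMr // -(ler_pM2r (exprn_gt0 3 n0)); apply: le_trans B4 _.
  by rewrite ler_wpM2l // exprn_ge0 // ltW.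
have hpairs : a ^+ s.+1 / 2 <= \sum_(t in A') \sum_(x in @ffun_on 'I_s A') (good x && [forall i, x i - t \in P])%:R.
  have card_om : #|@ffun_on 'I_s A'|%:R = a ^+ s :> R by rewrite card_ffun_on card_ord natrX.
  have h1 : \sum_(t in A') \sum_(x in @ffun_on 'I_s A') (~~ good x)%:R <= a ^+ s.+1 / 4.
    by rewrite sumr_const -[_ *+ #|A'|]mulr_natl exprS -mulrA ler_pM2l.
  have h2 : \sum_(t in A') \sum_(x in @ffun_on 'I_s A') \sum_(i < s) (x i - t \notin P)%:R <= a ^+ s.+1 / 4.
    have -> : \sum_(t in A') \sum_(x in @ffun_on 'I_s A') \sum_(i < s) (x i - t \notin P)%:R
        = s%:R * a ^+ s.-1 * \sum_(t in A') \sum_(u in A') (u - t \notin P)%:R.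
      rewrite mulr_sumr; apply: eq_bigr => t _; rewrite exchange_big /=.
      rewrite (eq_bigr (fun=> a ^+ s.-1 * \sum_(u in A') (u - t \notin P)%:R)).
        by rewrite sumr_const card_ord -mulrA mulr_natl.
      by move=> i _; rewrite (sum_ffun_on1 _ (fun u => (u - t \notin P)%:R)).
    rewrite exchange_big /=.
    have sa0 : 0 < s%:R * a ^+ s.-1 by pos.
    apply: le_trans (ler_wpM2l (ltW sa0) hbad) _.
    have sth : s%:R * th = 4^-1 by rewrite /th invfM mulrCA divff ?gt_eqF // mulr1.
    have -> : a ^+ s.+1 = a ^+ s.-1 * a ^+ 2 by rewrite -exprD addn2 prednK.
    have -> : s%:R * a ^+ s.-1 * (th * a ^+ 2) = (s%:R * th) * (a ^+ s.-1 * a ^+ 2) by ring.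
    by rewrite sth mulrC.
  have h3 : a ^+ s.+1 = \sum_(t in A') \sum_(x in @ffun_on 'I_s A') 1.
    by rewrite !sumr_const -[_ *+ #|A'|]mulr_natl -/a card_om exprS.
  have h4 : a ^+ s.+1 <= \sum_(t in A') \sum_(x in @ffun_on 'I_s A') (good x && [forall i, x i - t \in P])%:R
     + \sum_(t in A') \sum_(x in @ffun_on 'I_s A') (~~ good x)%:R
     + \sum_(t in A') \sum_(x in @ffun_on 'I_s A') \sum_(i < s) (x i - t \notin P)%:R.
    rewrite h3 -!big_split /=; apply: ler_sum => t _; rewrite -!big_split /=; apply: ler_sum => x _.
    have S0 : 0 <= \sum_(i < s) (x i - t \notin P)%:R :> R by apply: sumr_ge0.
    case: (good x) => /=; last by rewrite add0r lerDl.
    case: forallP => [_|nP] /=; first by rewrite addr0 lerDl.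
    have /existsP[i xi] : [exists i, x i - t \notin P].
      by rewrite -negb_forall; apply/negP => /forallP.
    rewrite !add0r (bigD1 i) //= xi lerDl; exact: sumr_ge0.
  by move: h1 h2 h4; lra.
(* Under [z = x - t], the sum of [#|Tz z|] over the tuples [z] of [P] dominates the count in
   [hpairs], so some [z] has a large fibre. *)
pose Tz (z : {ffun 'I_s -> G}) := [set t in A' | good [ffun i => z i + t] && [forall i, z i + t \in A']].
have [z hz] : exists z, a ^+ s.+1 / 2 <= #|P|%:R ^+ s * #|Tz z|%:R.
  pose Z := [set z | z \in @ffun_on 'I_s P].
  have ZE : #|Z|%:R = #|P|%:R ^+ s :> R by rewrite cardsE card_ffun_on card_ord natrX.
  have le_sum : a ^+ s.+1 / 2 <= \sum_(z in Z) #|Tz z|%:R.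
    apply: le_trans hpairs _.
    apply: (@le_trans _ _ (\sum_(t in A') \sum_(z in Z) (t \in Tz z)%:R)).
      apply: ler_sum => t tA.
      pose h (z : {ffun 'I_s -> G}) := [ffun i => z i + t].
      have h_inj : injective h.
        move=> z z' /ffunP hz; apply/ffunP => i; have := hz i; rewrite !ffunE; exact: addIr.
      rewrite [leLHS]big_mkcond [leRHS]big_mkcond [leLHS](reindex_inj h_inj) /=.
      apply: ler_sum => z _; rewrite !inE tA /=.
      case: ifP => [/ffun_onP hA|_]; last by case: ifP.
      case: (good (h z)); rewrite /=; last by case: ifP.
      case: forallP => [hPz|_]; last by case: ifP.
      rewrite ifT ?ler_nat.
        by case: forallP => // -[]; move=> i; have := hA i; rewrite ffunE.
      by apply/ffun_onP => i; have := hPz i; rewrite ffunE addrK.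
    rewrite exchange_big /=; apply: ler_sum => z _; rewrite sum_card ler_nat.
    by apply/subset_leq_card/subsetP => t; rewrite !inE => /andP[].
  have as0 : 0 < a ^+ s.+1 / 2 by pos.
  have Z0 : (0 < #|Z|)%N.
    rewrite lt0n; apply: contraTneq le_sum => /cards0_eq ->.
    by rewrite big_set0 -ltNge.
  have Z0R : 0 < #|Z|%:R :> R by rewrite ltr0n.
  have [z _ hz] : exists2 z, z \in Z & a ^+ s.+1 / 2 / #|Z|%:R <= #|Tz z|%:R.
    apply: exists_ge_sum => //; apply: le_trans le_sum.
    by rewrite sumr_const -[_ *+ #|Z|]mulr_natl mulrC divfK ?gt_eqF.
  by exists z; rewrite -ZE [leRHS]mulrC -ler_pdivrMr.
exists (Tz z), f; split.
- by apply: subset_trans sA'A; apply/subsetP => t; rewrite inE => /andP[].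
- have hP' : #|P|%:R <= 2 * C * D%:R ^+ 2 * a.
    apply: (@le_trans _ _ (C * n)).
      by rewrite /C mulrAC ler_pdivlMr // mulrC.
    apply: (@le_trans _ _ (C * (2 * D%:R ^+ 2 * a))); first by rewrite ler_wpM2l // ltW.
    by rewrite le_eqVlt; apply/predU1l; ring.
  have h1 : a ^+ s.+1 / 2 <= (2 * C * D%:R ^+ 2 * a) ^+ s * #|Tz z|%:R.
    apply: le_trans hz _; rewrite ler_wpM2r // lerXn2r ?nnegrE // ltW //; pos.
  have as0 : 0 < a ^+ s by exact: exprn_gt0.
  have h2 : a <= 2 * (2 * C * D%:R ^+ 2) ^+ s * #|Tz z|%:R.
    by rewrite -(ler_pM2l as0); move: h1; rewrite exprMn exprS; lra.
  rewrite mulrC ler_pdivrMr //.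
  have q0 : 0 < 2 * D%:R ^+ 2 :> R by pos.
  apply: le_trans nA' _; move: h2; rewrite -(ler_pM2l q0) /E; lra.
- split; last exact: conv_ge0.
  by rewrite sum_conv -/a -/n expr2 ler_wpM2r // ltW.
- exact: F2_ge.
- move=> t t'; rewrite !inE => /and3P[_ gt _] /and3P[_ gt' _].
  pose h y : R := a * \sum_(i < s) (y - z i \in A)%:R.
  have shift u : good [ffun i => z i + u] -> \sum_y (h y - s%:R * f (y + u)) ^+ 2 <= s%:R ^+ 2 * F2 / 64.
    apply: le_trans; rewrite [leRHS](reindex_inj (addIr u)) le_eqVlt; apply/predU1l/eq_bigr => y _.
    congr ((_ * _ - _) ^+ 2); apply: eq_bigr => i _.
    by rewrite ffunE opprD addrACA subrr addr0.
  have s2 : 0 < s%:R ^+ 2 :> R by pos.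
  have key : s%:R ^+ 2 * sqdist f t t' <= 2 * (\sum_y (h y - s%:R * f (y + t)) ^+ 2 + \sum_y (h y - s%:R * f (y + t')) ^+ 2).
    rewrite -big_split /= mulr_sumr mulr_sumr; apply: ler_sum => y _.
    have := sqr_ge0 (h y - s%:R * f (y + t) + (h y - s%:R * f (y + t'))); lra.
  rewrite -(ler_pM2l s2); move: (shift _ gt) (shift _ gt') key; rewrite -/F2; lra.
Qed.

(** * Growth of iterated sumsets *)

Section Sumset.
Variable G : finZmodType.
Implicit Types (X Y Z B : {set G}).

Definition sumset X Y : {set G} := [set x + y | x in X, y in Y].
Definition nsum X j : {set G} := iter j (sumset X) [set 0].

Lemma mem_sumset X Y x y : x \in X -> y \in Y -> x + y \in sumset X Y.
Proof. by move=> xX yY; apply/imset2P; exists x y. Qed.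

Lemma sumsetS X X' Y Y' : X \subset X' -> Y \subset Y' -> sumset X Y \subset sumset X' Y'.
Proof. by move=> sX sY; apply: imset2S. Qed.

Lemma sumsetA X Y Z : sumset X (sumset Y Z) = sumset (sumset X Y) Z.
Proof.
apply/setP => w; apply/imset2P/imset2P => -[].
  move=> x _ xX /imset2P[y z yY zZ ->] ->; exists (x + y) z; rewrite ?mem_sumset ?addrA //.
move=> _ z /imset2P[x y xX yY ->] zZ ->; exists x (y + z); rewrite ?mem_sumset ?addrA //.
Qed.

Lemma sumsetC X Y : sumset X Y = sumset Y X.
Proof.
by apply/setP => w; apply/imset2P/imset2P => -[x y xX yY ->]; exists y x; rewrite // addrC.
Qed.

Lemma sumset0l X : sumset [set 0] X = X.
Proof.
apply/setP => w; apply/imset2P/idP => [[_ x /set1P-> xX ->]|wX]; first by rewrite add0r.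
by exists 0 w; rewrite ?set11 ?add0r.
Qed.

Lemma nsumD X i j : nsum X (i + j) = sumset (nsum X i) (nsum X j).
Proof. by elim: i => [|i IH]; rewrite ?sumset0l // addSn /nsum iterS -/(nsum _ _) IH sumsetA. Qed.

Lemma mem_nsumD X i j x y : x \in nsum X i -> y \in nsum X j -> x + y \in nsum X (i + j).
Proof. by rewrite nsumD; exact: mem_sumset. Qed.

Lemma nsum1 X : nsum X 1 = X.
Proof. by rewrite /nsum /= sumsetC sumset0l. Qed.

Lemma subset_nsumS X j : 0 \in X -> nsum X j \subset nsum X j.+1.
Proof.
by move=> X0; rewrite -{1}[nsum X j]sumset0l; apply: sumsetS; rewrite ?sub1set.
Qed.

Lemma subset_nsum X i j : 0 \in X -> (i <= j)%N -> nsum X i \subset nsum X j.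
Proof.
move=> X0 /subnK <-; elim: (j - i)%N => // m IH; rewrite addSn.
exact: subset_trans IH (subset_nsumS _ X0).
Qed.

Lemma nsum0 X j : 0 \in X -> 0 \in nsum X j.
Proof. by move=> X0; apply: (subsetP (subset_nsum X0 (leq0n j))); rewrite set11. Qed.

(** By commutativity a [j]-fold sum depends only on its multiplicities, which are at most [j] and
    supported on [X]. *)
Lemma card_nsum X j : (#|nsum X j| <= j.+1 ^ #|X|)%N.
Proof.
pose ev (m : {ffun G -> 'I_j.+1}) : G := \sum_x x *+ m x.
pose Om := pffun_on (ord0 : 'I_j.+1) X predT.
have evP i : (i <= j)%N -> forall z, z \in nsum X i ->
    exists m : {ffun G -> 'I_j.+1}, [/\ m \in Om, forall x, (m x <= i)%N & z = ev m].
  elim: i => [_ z /set1P ->|i IH lt_ij _ /imset2P[x z xX /(IH (ltnW lt_ij)) [m [mO mi ->]] ->]].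
    exists [ffun=> ord0]; split=> [|x|]; first by apply/pffun_onP; split=> //; apply/subsetP => x; rewrite !inE ffunE eqxx.
      by rewrite ffunE.
    by rewrite /ev big1 // => x _; rewrite ffunE.
  have mE y : (m y + (y == x) <= i.+1)%N by have := mi y; case: (y == x); lia.
  exists [ffun y => inord (m y + (y == x))]; split=> [|y|].
  - apply/pffun_onP; split=> //; apply/subsetP => y; rewrite !inE ffunE.
    have /pffun_onP[/subsetP sX _] := mO.
    have [->//|yx] := eqVneq y x; rewrite addn0 inord_val => my; exact: sX.
  - by rewrite ffunE inordK ?mE // ltnS (leq_trans (mE y)).
  - rewrite /ev (bigD1 x) //= [in RHS](bigD1 x) //= addrA; congr (_ + _).
      by rewrite ffunE inordK eqxx ?addn1 ?mulrS // ltnS (leq_trans _ lt_ij) // ltnS mi.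
    by apply: eq_bigr => y /negPf yx; rewrite ffunE yx addn0 inord_val.
have -> : (j.+1 ^ #|X| = #|Om|)%N by rewrite card_pffun_on card_ord.
apply: leq_trans (leq_imset_card ev Om).
apply/subset_leq_card/subsetP => z /(evP j (leqnn j))[m [mO _ ->]]; exact: imset_f.
Qed.

(** Ruzsa covering: [X] is maximal in [nsum B 3] with the translates of [B] by its points pairwise
    disjoint. These fit in [nsum B 4], and by maximality each point of [nsum B 3] differs from one
    of [X] by an element of [nsum B 2]. *)
Lemma covering B : 0 \in B -> (forall b, b \in B -> - b \in B) ->
  exists2 X : {set G}, (#|X| * #|B| <= #|nsum B 4|)%N & nsum B 3 \subset sumset X (nsum B 2).
Proof.
move=> B0 BN.
have B2N b : b \in nsum B 2 -> - b \in nsum B 2.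
  rewrite -[2%N]/(1 + 1)%N nsumD !nsum1 => /imset2P[x y xB yB ->].
  by rewrite opprD mem_sumset ?BN.
pose sep X := (X \subset nsum B 3) && [forall x in X, forall y in X, (x - y \in nsum B 2) ==> (x == y)].
have sep0 : sep set0 by rewrite /sep sub0set; apply/forall_inP => x; rewrite inE.
have [X /maxsetP[/andP[sX /forall_inP sepX] maxX] _] := maxset_exists sep0.
exists X.
  rewrite -cardsX; pose h (p : G * G) := p.1 + p.2.
  rewrite -(card_in_imset (f := h)).
    apply/subset_leq_card/subsetP => _ /imsetP[[x b] /setXP[/= xX bB] ->].
    by apply: (@mem_nsumD _ 3 1); rewrite ?nsum1 // (subsetP sX).
  move=> [x b] [y c] /setXP[/= xX bB] /setXP[/= yX cB]; rewrite /h /= => e.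
  have xy : x - y = c + - b by apply: (addIr (b + y)); rewrite addrACA addNr addr0 addrA subrK e addrC.
  have /forall_inP/(_ y yX) := sepX _ xX.
  rewrite xy -[2%N]/(1 + 1)%N nsumD !nsum1 mem_sumset ?BN //= => /eqP xyE.
  by move: e; rewrite xyE => /addrI ->.
apply/subsetP => z zB.
suff [x xX xz] : exists2 x, x \in X & z - x \in nsum B 2.
  by rewrite -(subrK x z) addrC mem_sumset.
have [zX|zX] := boolP (z \in X); first by exists z; rewrite // subrr nsum0.
apply/exists_inP; apply: contraR zX; rewrite negb_exists_in => /forall_inP far.
rewrite -(maxX (z |: X)) ?setU11 ?subsetUr // /sep subUset sub1set zB sX /=.
apply/forall_inP => x /setU1P[->|xX]; apply/forall_inP => y /setU1P[->|yX]; rewrite ?eqxx ?implybT //.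
- by rewrite (negPf (far _ yX)).
- by rewrite -opprB; apply/implyP => /B2N; rewrite opprK (negPf (far _ xX)).
- by have /forall_inP := sepX _ xX; apply.
Qed.

(** Iterating the covering puts [nsum B j.+2] inside [nsum X j] plus [nsum B 2], where [X] has at
    most [K] points; only [nsum X j] still depends on [j]. *)
Lemma card_nsum_poly B K j : 0 \in B -> (forall b, b \in B -> - b \in B) ->
  (#|nsum B 4| <= K * #|B|)%N -> (#|nsum B j.+2| <= j.+1 ^ K * (K * #|B|))%N.
Proof.
move=> B0 BN hK; have [X cX sX] := covering B0 BN.
have XK : (#|X| <= K)%N.
  by rewrite -(@leq_pmul2r #|B|); [exact: leq_trans hK | rewrite (cardD1 0) B0].
have sub i : nsum B i.+2 \subset sumset (nsum X i) (nsum B 2).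
  elim: i => [|i IH]; first by rewrite sumset0l.
  apply: subset_trans (sumsetS (subxx B) IH) _.
  rewrite sumsetA [sumset B _]sumsetC -sumsetA -[sumset B (nsum B 2)]/(nsum B 3).
  apply: subset_trans (sumsetS (subxx _) sX) _.
  by rewrite sumsetA -[X in sumset (sumset _ X)]nsum1 -nsumD addn1.
apply: leq_trans (subset_leq_card (sub j)) _.
apply: leq_trans (_ : #|nsum X j| * #|nsum B 2| <= _)%N; first by rewrite /sumset curry_imset2X (leq_trans (leq_imset_card _ _)) ?cardsX.
apply: leq_mul; first by apply: leq_trans (card_nsum _ _) _; exact: leq_pexp2l.
exact: leq_trans (subset_leq_card (subset_nsum B0 _)) hK.
Qed.

End Sumset.

Lemma exp_beats_poly (R : archiRealFieldType) (z : R) (K : nat) : 0 < z ->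
  exists J : nat, (J.+1 ^ K * K)%:R < (1 + z) ^+ J.+1.
Proof.
move=> z0; set y : R := ((K.+1 ^ K * K)%:R / z ^+ K.+1).
have zK : 0 < z ^+ K.+1 by rewrite exprn_gt0.
have y0 : 0 <= y by rewrite divr_ge0 // ltW.
set M := Num.bound y; have yM : y < M%:R by exact: archi_boundP.
have M0 : (0 < M)%N by rewrite -(ltr_nat R) (le_lt_trans y0).
(* Bernoulli gives [(1 + z) ^+ M > M%:R * z]; the power [K.+1] of this beats the polynomial by one
   extra factor [M], which exceeds [y]. *)
exists (M * K.+1).-1; rewrite prednK ?muln_gt0 ?M0 // exprM.
have M0R : 0 < M%:R :> R by rewrite ltr0n.
have bern : 1 + M%:R * z <= (1 + z) ^+ M.
  elim: M {yM M0 M0R} => [|M IH]; first by rewrite mul0r addr0.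
  rewrite exprS; apply: le_trans (ler_wpM2l _ IH); last by rewrite addr_ge0 // ltW.
  have : 0 <= z * (M%:R * z) by rewrite !mulr_ge0 // ltW.
  rewrite -natr1; lra.
apply: lt_le_trans (_ : (M%:R * z) ^+ K.+1 <= _); last first.
  rewrite lerXn2r ?nnegrE ?exprn_ge0 ?mulr_ge0 ?addr_ge0 // ?ltW //.
  by apply: lt_le_trans bern; rewrite ltrDr.
move: yM; rewrite /y ltr_pdivrMr // => yM.
rewrite expnMn -mulnA natrM natrX exprMn [M%:R ^+ K.+1]exprSr -mulrA.
by rewrite ltr_pM2l // exprn_gt0.
Qed.

(** Otherwise every early step multiplies the size by more than [1 + z], and this exponential growth
    overtakes the bound of [card_nsum_poly]. *)
Lemma slow_growth (R : archiRealFieldType) (z : R) (K : nat) : 0 < z ->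
  exists J : nat, forall (G : finZmodType) (B : {set G}),
    0 \in B -> (forall b, b \in B -> - b \in B) -> (#|nsum B 4| <= K * #|B|)%N ->
    exists2 j, (#|nsum B j| <= J * #|B|)%N & #|nsum B j.+1|%:R <= (1 + z) * #|nsum B j|%:R.
Proof.
move=> z0; have [J hJ] := exp_beats_poly K z0.
exists (J.+1 ^ K * K)%N => G B B0 BN hK.
have le_card j : (j <= J.+2)%N -> (#|nsum B j| <= J.+1 ^ K * K * #|B|)%N.
  move=> jJ; rewrite -mulnA; apply: leq_trans (card_nsum_poly J B0 BN hK).
  by rewrite subset_leq_card // subset_nsum.
have [/existsP[j hj]|] := boolP [exists j : 'I_J.+2, #|nsum B j.+1|%:R <= (1 + z) * #|nsum B j|%:R].
  by exists j => //; apply: le_card; rewrite ltnW.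
rewrite negb_exists => /forallP hgrow.
have grow j : (j <= J.+1)%N -> (1 + z) ^+ j * #|B|%:R <= #|nsum B j.+1|%:R.
  elim: j => [_|j IH jJ]; first by rewrite mul1r nsum1.
  have := hgrow (Ordinal (jJ : j.+1 < J.+2)%N); rewrite -ltNge /= => /ltW; apply: le_trans.
  rewrite exprS -mulrA; apply: ler_wpM2l; last exact: IH (ltnW jJ).
  by rewrite addr_ge0 // ltW.
have := le_card J.+2 (leqnn _); have := grow J.+1 (leqnn _).
have B0R : 0 < #|B|%:R :> R by rewrite ltr0n (cardD1 0) B0.
rewrite -(ler_nat R) natrM => h1 h2; have := le_trans h1 h2.
by rewrite ler_pM2r // leNgt hJ.
Qed.

(** * Distances between translates and almost invariant sets *)

Section SqDist.
Variables (R : realFieldType) (G : finZmodType) (f : G -> R).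

Lemma sqdistC b c : sqdist f b c = sqdist f c b.
Proof. by apply: eq_bigr => y _; rewrite -sqrrN opprB. Qed.

Lemma sqdistDr b c u : sqdist f (b + u) (c + u) = sqdist f b c.
Proof.
rewrite /sqdist [RHS](reindex_inj (addIr u)); apply: eq_bigr => y _.
by rewrite -!addrA ![u + _]addrC.
Qed.

Lemma sqdist_trans b c d : sqdist f b d <= 2 * (sqdist f b c + sqdist f c d).
Proof.
rewrite -big_split /= mulr_sumr; apply: ler_sum => y _.
set u := f (y + b); set v := f (y + c); set w := f (y + d).
have := sqr_ge0 (u - v - (v - w)); lra.
Qed.

Lemma sqdistD b c : sqdist f (b + c) 0 <= 2 * (sqdist f b 0 + sqdist f c 0).
Proof. by have := sqdist_trans (b + c) c 0; have := sqdistDr b 0 c; rewrite add0r => ->. Qed.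

Lemma sqdist_inner b : sqdist f b 0 = 2 * \sum_y f y ^+ 2 - 2 * \sum_y f (y + b) * f y.
Proof.
rewrite /sqdist (eq_bigr (fun y => f (y + b) ^+ 2 + (f y ^+ 2 - 2 * (f (y + b) * f y)))).
  have e : \sum_y f (y + b) ^+ 2 = \sum_y f y ^+ 2 by rewrite [RHS](reindex_inj (addIr b)).
  by rewrite !big_split /= sumrN -mulr_sumr e; ring.
by move=> y _; rewrite addr0; ring.
Qed.

Lemma sum_inner : \sum_b \sum_y f (y + b) * f y = (\sum_y f y) ^+ 2.
Proof.
rewrite exchange_big /= expr2 mulr_suml; apply: eq_bigr => y _.
rewrite mulrC mulr_suml [RHS](reindex_inj (addrI y)); apply: eq_bigr => b _.
by [].
Qed.

(** Each [b] in [S] has autocorrelation at least half of [\sum_y f y ^+ 2], while all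
    autocorrelations add up to [(\sum_y f y) ^+ 2]. *)
Lemma card_half_ball (S : {set G}) : (forall y, 0 <= f y) ->
  (forall b, b \in S -> sqdist f b 0 <= \sum_y f y ^+ 2) ->
  #|S|%:R * \sum_y f y ^+ 2 <= 2 * (\sum_y f y) ^+ 2.
Proof.
move=> f0 hS; rewrite -sum_inner mulr_natl -sumr_const mulr_sumr [leLHS]big_mkcond.
apply: ler_sum => b _; case: ifP => [/hS|_]; first by rewrite sqdist_inner; lra.
by rewrite mulr_ge0 // sumr_ge0 // => y _; rewrite mulr_ge0.
Qed.

End SqDist.

(** The ball [B] of almost-periods contains [T - T], and [nsum B 4] exceeds it by a bounded factor
    only. Where the iterated sums of [B] barely grow, a translation by an element of [B] moves at
    most a proportion [z] of [nsum B j] outside it. *)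
Lemma invariant_set (R : archiRealFieldType) (D : nat) : (0 < D)%N ->
  exists2 d : R, 0 < d & forall z : R, 0 < z ->
  exists2 C : R, 0 < C & forall (G : finZmodType) (A : {set G}),
  (0 < #|A|)%N ->
  #|A|%:R ^+ 2 <= D%:R * \sum_(x in A) \sum_(y in A) (ends3 A x y)%:R :> R ->
  exists T F : {set G},
    [/\ T \subset A, d * #|A|%:R <= #|T|%:R, (0 < #|F|)%N, #|F|%:R <= C * #|A|%:R
      & {in T &, forall t t', (1 - z) * #|F|%:R <= #|[set y in F | y + (t - t') \in F]|%:R}].
Proof.
move=> D0; have D0R : 0 < D%:R :> R by rewrite ltr0n.
have [d d0 hd] := almost_periods R D0.
exists d => // z z0.
pose E : R := 8 * D%:R ^+ 4.
have E0 : 0 < E by rewrite /E; pos.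
pose K := Num.bound (E / d).
have hK : E / d <= K%:R by rewrite ltW // archi_boundP // divr_ge0 // ltW.
have [J hJ] := slow_growth K z0.
exists ((J%:R + 1) * E) => [|G A A0 /(hd _ _ A0)[T [f [sTA dT [fS f0] f2 hT]]]].
  by rewrite mulr_gt0 // ltr_wpDl.
set n : R := #|A|%:R in dT fS f2 *; set F2 := \sum_y f y ^+ 2 in f2 hT.
have n0 : 0 < n by rewrite ltr0n.
have [t0 t0T] : exists t0, t0 \in T.
  apply/card_gt0P; rewrite -(ltr_nat R); apply: lt_le_trans dT; exact: mulr_gt0.
have F20 : 0 < F2.
  have := lt_le_trans (exprn_gt0 3 n0) f2.
  by rewrite pmulr_rgt0 //; pos.
(* Each of the two doublings up to [nsum B 4] costs a factor 4, so the radius [F2 / 16] becomes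
   [F2], as [card_half_ball] requires. *)
pose B := [set b | 16 * sqdist f b 0 <= F2].
have B0 : 0 \in B.
  rewrite inE /sqdist big1 ?mulr0 ?ltW // => y _; by rewrite subrr expr0n.
have BN b : b \in B -> - b \in B.
  by rewrite !inE -(sqdistDr f (- b) 0 b) addNr add0r sqdistC.
have TB t t' : t \in T -> t' \in T -> t - t' \in B.
  by move=> tT t'T; rewrite inE -(sqdistDr f _ _ t') subrK add0r hT.
have cB : d * n <= #|B|%:R.
  apply: le_trans dT _; rewrite ler_nat -(card_imset _ (addIr (- t0))).
  by apply/subset_leq_card/subsetP => _ /imsetP[t tT ->]; rewrite TB.
have c4B : #|nsum B 4|%:R <= E * n.
  have h4 b : b \in nsum B 4 -> sqdist f b 0 <= F2.
    rewrite /= => /imset2P[b1 _ + /imset2P[b2 _ + /imset2P[b3 _ + /imset2P[b4 _ + /set1P-> ->] ->] ->] ->].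
    rewrite !inE addr0 addrA => h1 h2 h3 h4.
    have := sqdistD f (b1 + b2) (b3 + b4); have := sqdistD f b1 b2; have := sqdistD f b3 b4.
    lra.
  have := card_half_ball f0 h4; rewrite -/F2 => h.
  have h' : (\sum_y f y) ^+ 2 <= n ^+ 4.
    rewrite -[4%N]/(2 * 2)%N exprM lerXn2r ?nnegrE ?exprn_ge0 ?(ltW n0) //.
    exact: sumr_ge0.
  rewrite -(ler_pM2r F20); apply: le_trans h _.
  have n1 : n * n ^+ 3 <= n * (4 * D%:R ^+ 4 * F2) by rewrite ler_pM2l.
  move: h' n1; rewrite /E exprS; clear; lra.
have hKB : (#|nsum B 4| <= K * #|B|)%N.
  rewrite -(ler_nat R) natrM; apply: le_trans c4B _.
  apply: le_trans (_ : E / d * #|B|%:R <= _); last by rewrite ler_wpM2r.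
  by rewrite -mulrA ler_pM2l // mulrC ler_pdivlMr // mulrC.
have [j cj growj] := hJ G B B0 BN hKB.
pose F := nsum B j.
have F0 : 0 \in F by exact: nsum0.
exists T, F; split => //; first by apply/card_gt0P; exists 0.
  apply: (@le_trans _ _ (J%:R * #|nsum B 4|%:R)).
    rewrite -natrM ler_nat (leq_trans cj) // leq_mul2l; apply/orP; right.
    by rewrite -{1}(nsum1 B) subset_leq_card // subset_nsum.
  apply: (@le_trans _ _ (J%:R * (E * n))); first by rewrite ler_wpM2l.
  have : 0 < E * n by exact: mulr_gt0.
  rewrite -/n; clear; lra.
move=> t t' /TB tT /tT; set b := t - t' => bB {tT}.
pose F1 := [set y in F | y + b \in F]; pose F2' := [set y in F | y + b \notin F].
have cF : #|F| = (#|F1| + #|F2'|)%N.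
  by rewrite -(cardsID [set y | y + b \in F]); congr (_ + _)%N; apply: eq_card => y; rewrite !inE // andbC.
have cU : (#|F| + #|F2'| <= #|nsum B j.+1|)%N.
  rewrite -(card_imset F2' (addIr b)) -cardsUI.
  rewrite [X in (_ + X)%N](_ : _ = 0)%N ?addn0.
    apply/subset_leq_card; rewrite subUset subset_nsumS //=.
    apply/subsetP => _ /imsetP[y yF2 ->]; rewrite addrC; apply: mem_sumset => //.
    by move: yF2; rewrite inE => /andP[].
  apply/eqP; rewrite cards_eq0 -subset0; apply/subsetP => y /setIP[yF /imsetP[x xF2 yx]].
  by move: xF2; rewrite inE -yx yF andbF.
move: growj; rewrite -/F -/F1 => growj.
have : #|F|%:R + #|F2'|%:R <= (1 + z) * #|F|%:R :> R.
  by apply: le_trans growj; rewrite -natrD ler_nat.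
have : #|F|%:R = #|F1|%:R + #|F2'|%:R :> R by rewrite cF natrD.
clear; lra.
Qed.

(** * Fourier analysis on Z/N *)

(* Distance to [0] on the circle [Z/N]. *)
Definition zn (N : nat) (x : 'Z_N) : nat := minn x (N - x).

Lemma ltZ (N : nat) (x : 'Z_N) : (1 < N)%N -> (x < N)%N.
Proof. by move=> N1; have := ltn_ord x; rewrite {2}Zp_cast. Qed.

Lemma zn0 (N : nat) : zn (0 : 'Z_N) = 0%N.
Proof. by rewrite /zn min0n. Qed.

Lemma zn_eq0 (N : nat) (x : 'Z_N) : (1 < N)%N -> (zn x == 0%N) = (x == 0).
Proof.
move=> N1; have xN := ltZ x N1; rewrite -val_eqE /= /zn; apply/eqP/eqP; lia.
Qed.

Section Characters.
Variables (R : realType) (N : nat).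
Hypothesis N1 : (1 < N)%N.
Implicit Types (x y : 'Z_N).

Let N0 : 0 < N%:R :> R. Proof. by rewrite ltr0n ltnW. Qed.
Let Nn0 : N%:R != 0 :> R. Proof. by rewrite gt_eqF. Qed.

Definition ang (a : nat) : R := (pi *+ 2) * (a%:R / N%:R).
(** With [sinZ], the real and imaginary parts of the character [exp (2 pi i x / N)]. *)
Definition cosZ x : R := cos (ang x).
Definition sinZ x : R := sin (ang x).

Lemma angD a b : ang (a + b) = ang a + ang b.
Proof. by rewrite /ang natrD [(_ + _) / _]mulrDl mulrDr. Qed.

Lemma ang_modn a : ang a = ang (a %% N) + (pi *+ 2) *+ (a %/ N).
Proof.
rewrite {1}(divn_eq a N) addnC angD; congr (_ + _).
by rewrite /ang natrM mulfK // mulr_natr.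
Qed.

Lemma cosZD x y : cosZ (x + y) = cosZ x * cosZ y - sinZ x * sinZ y.
Proof.
rewrite -cosD -angD ang_modn (periodicn (@cosD2pi R)) /cosZ /=.
by rewrite [in X in (_ %% X)%N]Zp_cast.
Qed.

Lemma sinZD x y : sinZ (x + y) = sinZ x * cosZ y + cosZ x * sinZ y.
Proof.
rewrite -sinD -angD ang_modn (periodicn (@sinD2pi R)) /sinZ /=.
by rewrite [in X in (_ %% X)%N]Zp_cast.
Qed.

Lemma cosZ0 : cosZ 0 = 1. Proof. by rewrite /cosZ /ang mul0r mulr0 cos0. Qed.
Lemma sinZ0 : sinZ 0 = 0. Proof. by rewrite /sinZ /ang mul0r mulr0 sin0. Qed.

Lemma cosZ_zn x : cosZ x = cos (ang (zn x)).
Proof.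
rewrite /cosZ /zn; have xN := ltnW (ltZ x N1); case: leqP => // _.
have e : ang x = - ang (N - x) + pi *+ 2.
  by rewrite addrC /ang natrB // [(_ - _) / _]mulrBl divff // mulrBr mulr1 subKr.
by rewrite e cosD2pi cosN.
Qed.

Lemma cosZ_lt (eta : R) x : 0 <= eta <= 2^-1 -> eta * N%:R < (zn x)%:R ->
  cosZ x < cos (pi *+ 2 * eta).
Proof.
move=> /andP[e0 e2] h; have p0 := pi_gt0 R; have p0' := ltW p0.
have pi2 : 0 <= pi *+ 2 :> R by exact: mulrn_wge0.
have z2 : (zn x)%:R / N%:R <= 2^-1 :> R.
  rewrite ler_pdivrMr // ler_pdivlMl // -natrM ler_nat /zn; have := ltZ x N1; lia.
have in1 : 0 <= pi *+ 2 * eta <= pi.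
  by rewrite mulr_ge0 //; move: e2; rewrite -(ler_pM2l p0) -[pi *+ 2]mulr_natl; lra.
have in2 : 0 <= ang (zn x) <= pi.
  by rewrite mulr_ge0 ?divr_ge0 //; move: z2; rewrite /ang -(ler_pM2l p0) -[pi *+ 2]mulr_natl; lra.
rewrite cosZ_zn ltr_cos ?in_itv //.
by rewrite ltr_pM2l ?ltr_pdivlMr // pmulrn_rgt0.
Qed.

Lemma cosZ_eq1 x : cosZ x = 1 -> x = 0.
Proof.
move=> h; apply/eqP; rewrite -zn_eq0 //; apply/negP => /negP; rewrite -lt0n => z0.
have := @cosZ_lt 0 x; rewrite !lexx invr_ge0 ler0n mul0r ltr0n z0 mulr0 cos0 h ltxx.
by move=> /(_ isT isT).
Qed.

(** Shifting [l] by 1 rotates the vector [(C, S)] by the angle of [x]; a rotation other than the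
    identity fixes only 0. *)
Lemma sum_cosZ x : \sum_(l : 'Z_N) cosZ (l * x) = if x == 0 then N%:R else 0.
Proof.
case: eqVneq => [->|x0].
  rewrite (eq_bigr (fun=> 1)) => [|l _]; last by rewrite mulr0 cosZ0.
  by rewrite sumr_const card_ord Zp_cast.
set C := \sum_l _; pose S := \sum_(l : 'Z_N) sinZ (l * x).
have eC : C = C * cosZ x - S * sinZ x.
  rewrite /C /S !mulr_suml -sumrB [LHS](reindex_inj (addIr 1)) /=.
  by apply: eq_bigr => l _; rewrite mulrDl mul1r cosZD.
have eS : S = S * cosZ x + C * sinZ x.
  rewrite /C /S !mulr_suml -big_split /= [LHS](reindex_inj (addIr 1)) /=.
  by apply: eq_bigr => l _; rewrite mulrDl mul1r sinZD.
have c1 : 0 < (1 - cosZ x) ^+ 2 + sinZ x ^+ 2.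
  rewrite ltr_pwDl ?sqr_ge0 // lt_def sqr_ge0 andbT sqrf_eq0 subr_eq0 eq_sym.
  by apply: contraNneq x0 => /cosZ_eq1 ->.
have e1 : C * (1 - cosZ x) = - (S * sinZ x) by rewrite mulrBr mulr1 {1}eC; ring.
have e2 : S * (1 - cosZ x) = C * sinZ x by rewrite mulrBr mulr1 {1}eS; ring.
have : C * ((1 - cosZ x) ^+ 2 + sinZ x ^+ 2) = 0.
  by rewrite mulrDr !expr2 !mulrA e1 -e2; ring.
by move/eqP; rewrite mulf_eq0 (gt_eqF c1) orbF => /eqP.
Qed.

Lemma cosZN_sinZN x : cosZ (- x) = cosZ x /\ sinZ (- x) = - sinZ x.
Proof.
have c0 := cosZD x (- x); have s0 := sinZD x (- x).
have cs : cosZ x ^+ 2 + sinZ x ^+ 2 = 1 by rewrite cos2Dsin2.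
move: c0 s0 cs; rewrite subrr cosZ0 sinZ0.
move: (cosZ x) (sinZ x) (cosZ (- x)) (sinZ (- x)) => c s c' s' h1 h2 h3; split.
  rewrite -[c']mulr1 -h3 [RHS](_ : _ = c * (c * c' - s * s') + s * (s * c' + c * s')); first by ring.
  by rewrite -h1 -h2; ring.
rewrite -[s']mulr1 -h3 [RHS](_ : _ = c * (s * c' + c * s') - s * (c * c' - s * s')); first by ring.
by rewrite -h1 -h2; ring.
Qed.

Variable F : {set 'Z_N}.

Definition fourier2 (l : 'Z_N) : R :=
  (\sum_(x in F) cosZ (l * x)) ^+ 2 + (\sum_(x in F) sinZ (l * x)) ^+ 2.

Lemma fourier2_ge0 l : 0 <= fourier2 l. Proof. by rewrite addr_ge0 ?sqr_ge0. Qed.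

Lemma fourier2_0 : fourier2 0 = #|F|%:R ^+ 2.
Proof.
rewrite /fourier2 (eq_bigr (fun=> 1)) => [|x _]; last by rewrite mul0r cosZ0.
rewrite [X in _ + X ^+ 2]big1 => [|x _]; last by rewrite mul0r sinZ0.
by rewrite sumr_const expr0n addr0.
Qed.

Lemma fourier2_cosZ l b : fourier2 l * cosZ (l * b) = \sum_(x in F) \sum_(y in F) cosZ (l * (x + b - y)).
Proof.
set c := cosZ (l * b); set s := sinZ (l * b).
pose cc x := cosZ (l * x); pose ss x := sinZ (l * x).
rewrite (eq_bigr (fun x => \sum_(y in F) ((cc x * c - ss x * s) * cc y + (ss x * c + cc x * s) * ss y))).
  pose Cs := \sum_(x in F) cc x; pose Ss := \sum_(x in F) ss x.
  transitivity (\sum_(x in F) ((cc x * c - ss x * s) * Cs + (ss x * c + cc x * s) * Ss)).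
    rewrite big_split /= -!mulr_suml sumrB big_split /= -!mulr_suml /fourier2 -/Cs -/Ss; ring.
  by apply: eq_bigr => x _; rewrite !mulr_sumr -big_split.
move=> x _; apply: eq_bigr => y _.
have [cN sN] := cosZN_sinZN (l * y).
by rewrite mulrBr mulrDr cosZD cN sN [cosZ (_ + _)]cosZD [sinZ (_ + _)]sinZD mulrN opprK.
Qed.

(** Fourier inversion of the autocorrelation of [F]; at [b = 0] this is Parseval. *)
Lemma sum_fourier2_cosZ b : \sum_l fourier2 l * cosZ (l * b) = N%:R * #|[set x in F | x + b \in F]|%:R.
Proof.
under eq_bigr do rewrite fourier2_cosZ.
rewrite exchange_big /= -sum1dep_card natr_sum mulr_sumr.
rewrite [RHS]big_mkcondr /=.
apply: eq_bigr => x xF; rewrite exchange_big /=.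
under eq_bigr do rewrite sum_cosZ subr_eq0.
case: ifP => xb.
  rewrite (bigD1 (x + b)) //= eqxx big1 ?addr0 ?mulr1 // => y /andP[_]; rewrite eq_sym.
  by move=> /negPf->.
by rewrite big1 // => y yF; case: eqP => // e; move: xb; rewrite e yF.
Qed.

End Characters.

(** Almost invariance bounds the average of the sums [S l] weighted by [fourier2]. The frequency 0
    carries [m ^+ 2], at most half of the total mass [N%:R * m], so discarding it costs a factor 2;
    the constant 3 leaves room for strictness. *)
Lemma concentrate_translates (R : realType) (N : nat) (z : R) (T F : {set 'Z_N}) (t0 : 'Z_N) :
  (1 < N)%N -> 0 < z -> (0 < #|T|)%N -> (0 < #|F|)%N -> 2 * #|F|%:R <= N%:R :> R ->
  (forall t, t \in T -> (1 - z) * #|F|%:R <= #|[set y in F | y + (t - t0) \in F]|%:R) ->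
  exists2 l : 'Z_N, l != 0 & \sum_(t in T) (1 - cosZ R (l * (t - t0))) <= 3 * z * #|T|%:R.
Proof.
move=> N1 z0 T0 F0 FN hF; set m : R := #|F|%:R in FN hF.
have m0 : 0 < m by rewrite ltr0n.
have N0 : 0 < N%:R :> R by rewrite ltr0n ltnW.
pose S l := \sum_(t in T) (1 - cosZ R (l * (t - t0))).
have sumP : \sum_l fourier2 R F l = N%:R * m.
  have := sum_fourier2_cosZ R N1 F 0.
  under eq_bigr do rewrite mulr0 cosZ0 mulr1.
  by move=> ->; congr (_ * _%:R); apply: eq_card => x; rewrite !inE addr0 andbb.
have sumPS : \sum_l fourier2 R F l * S l <= z * N%:R * m * #|T|%:R.
  under eq_bigr do rewrite mulr_sumr.
  have -> : z * N%:R * m * #|T|%:R = \sum_(t in T) z * N%:R * m by rewrite sumr_const mulr_natr.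
  rewrite exchange_big /=; apply: ler_sum => t tT.
  under eq_bigr do rewrite mulrBr mulr1.
  rewrite sumrB sumP sum_fourier2_cosZ //.
  apply: (@le_trans _ _ (N%:R * m - N%:R * ((1 - z) * m))); last by clear; lra.
  by rewrite lerB // ler_pM2l // hF.
have [/exists_inP[l l0 hl]|] := boolP [exists l in [pred l : 'Z_N | l != 0], S l <= 3 * z * #|T|%:R].
  by exists l.
rewrite negb_exists_in => /forall_inP hS; exfalso.
have T0R : 0 < #|T|%:R :> R by rewrite ltr0n.
have : (N%:R * m - m ^+ 2) * (3 * z * #|T|%:R) <= \sum_l fourier2 R F l * S l.
  rewrite (bigD1 0) //= /S big1 ?mulr0 ?add0r => [|t _]; last by rewrite mul0r cosZ0 subrr.
  move: sumP; rewrite (bigD1 0) //= fourier2_0 -/m => <-; rewrite addrAC subrr add0r mulr_suml.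
  apply: ler_sum => l l0; rewrite ler_wpM2l ?fourier2_ge0 //.
  by have := hS l l0; rewrite -ltNge => /ltW.
move=> h; have := le_trans h sumPS.
have zT : 0 < z * #|T|%:R * m by rewrite !mulr_gt0.
have : 0 <= (z * #|T|%:R * m) * (N%:R - 2 * m) by rewrite mulr_ge0 ?subr_ge0 // ltW.
have : 0 < (z * #|T|%:R * m) * N%:R by rewrite mulr_gt0.
clear; lra.
Qed.

(** Almost invariance yields a nonzero frequency whose character is on average nearly constant on
    [T], so half of [T] falls in an arc around [l * t0]. As [d] precedes [eta], shortening the arc
    loses no proportion. *)
Lemma concentration (R : realType) (D : nat) : (0 < D)%N ->
  exists2 d : R, 0 < d & forall eta : R, 0 < eta ->
  exists2 c : R, 0 < c & forall (N : nat) (A : {set 'Z_N}), (1 < N)%N ->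
  (0 < #|A|)%N -> #|A|%:R <= c * N%:R ->
  #|A|%:R ^+ 2 <= D%:R * \sum_(x in A) \sum_(y in A) (ends3 A x y)%:R :> R ->
  exists l u : 'Z_N, l != 0 /\
    d * #|A|%:R <= #|[set x in A | (zn (l * x - u))%:R <= eta * N%:R]|%:R.
Proof.
move=> D0; have [d d0 hd] := @invariant_set R D D0.
exists (d / 2) => [|eta0 eta00]; first by rewrite divr_gt0.
(* The cap keeps [2 pi eta] in [[0, pi]], where the cosine decreases. *)
pose eta := Num.min eta0 4^-1.
have eta_gt0 : 0 < eta by rewrite lt_min eta00 invr_gt0 /=.
have eta_le : eta <= 4^-1 by rewrite ge_min lexx orbT.
pose ka : R := 1 - cos (pi *+ 2 * eta).
have ka0 : 0 < ka.
  have p0 := pi_gt0 R; have p0' := ltW p0.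
  have pe : pi * eta <= pi * 4^-1 :> R by rewrite ler_pM2l.
  have pe0 : 0 < pi * eta :> R by rewrite mulr_gt0.
  have e2 : pi *+ 2 * eta = 2 * (pi * eta) by rewrite mulrA mulr_natl.
  have in1 : 0 <= (0 : R) <= pi by rewrite lexx.
  have in2 : 0 <= 2 * (pi * eta) <= pi by apply/andP; split; lra.
  by rewrite subr_gt0 -(@cos0 R) e2 ltr_cos ?in_itv //; lra.
(* A point off the arc costs at least [ka], and [z = ka / 6] bounds the total cost by [ka / 2] times
   [#|T|]; so at most half of [T] is off the arc. *)
have [C C0 hC] := hd (ka / 6) (divr_gt0 ka0 (ltr0Sn _ _)).
exists (2 * C)^-1 => [|N A N1 A0 Ac hE]; first by rewrite invr_gt0; pos.
have [T [F [sTA dT F0 FC hF]]] := hC _ A A0 hE.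
have N0 : 0 < N%:R :> R by rewrite ltr0n ltnW.
have T0 : (0 < #|T|)%N.
  by rewrite -(ltr_nat R); apply: lt_le_trans dT; rewrite mulr_gt0 // ltr0n.
have [t0 t0T] := card_gt0P T0.
have FN : 2 * #|F|%:R <= N%:R :> R.
  move: Ac; rewrite mulrC ler_pdivlMr ?mulr_gt0 // => Ac; lra.
have z0 : 0 < ka / 6 by rewrite divr_gt0.
have [l l0 hl] := concentrate_translates N1 z0 T0 F0 FN (fun t tT => hF t t0 tT t0T).
exists l, (l * t0); split => //.
pose B := [set t in T | eta * N%:R < (zn (l * t - l * t0))%:R].
have cB : ka * #|B|%:R <= 3 * (ka / 6) * #|T|%:R.
  apply: le_trans hl; rewrite mulr_natr -sumr_const [leLHS]big_mkcond [leRHS]big_mkcond /=.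
  apply: ler_sum => t _; rewrite inE; case: (t \in T) => //=.
  case: ltP => [ht|_]; last by rewrite subr_ge0 cos_le1.
  rewrite lerB // mulrBr ltW // cosZ_lt // (ltW eta_gt0) /=; lra.
have cB2 : #|B|%:R <= #|T|%:R / 2 :> R.
  by rewrite -(ler_pM2l ka0); move: cB; clear; lra.
have cT : #|T|%:R = #|B|%:R + #|T :\: B|%:R :> R.
  rewrite -natrD -(cardsID B T); congr (_ + _)%:R; apply: eq_card => t; rewrite !inE.
  by case: (t \in T).
apply: le_trans (_ : #|T :\: B|%:R <= _); first by move: dT cT cB2; clear; lra.
rewrite ler_nat; apply/subset_leq_card/subsetP => t /setDP[tT tB].
rewrite inE (subsetP sTA) //=; move: tB; rewrite inE tT /= -leNgt => /le_trans; apply.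
by rewrite ler_pM2r // ge_min lexx.
Qed.

(** * Dilations modulo a prime *)

Section Zn.
Variable N : nat.
Hypothesis N1 : (1 < N)%N.
Implicit Types (x y v : 'Z_N).

Lemma valZD x y : (x + y : 'Z_N) = (if x + y < N then x + y else x + y - N)%N :> nat.
Proof.
rewrite /= [in X in (_ %% X)%N]Zp_cast //; have xN := ltZ x N1; have yN := ltZ y N1.
case: ltnP => h; first by rewrite modn_small.
by rewrite -[in LHS](subnK h) modnDr modn_small //; lia.
Qed.

Lemma valZN x : (- x : 'Z_N) = (if x == 0 :> nat then 0 else N - x)%N :> nat.
Proof.
rewrite /= [in X in (X - _)%N]Zp_cast // [in X in (_ %% X)%N]Zp_cast //; have xN := ltZ x N1.
by case: eqP => [->|x0]; rewrite ?subn0 ?modnn // modn_small; lia.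
Qed.

Lemma znD x y : (zn (x + y)%R <= zn x + zn y)%N.
Proof. rewrite /zn valZD; have := ltZ x N1; have := ltZ y N1; case: ifP; lia. Qed.

Lemma znN x : zn (- x) = zn x.
Proof. rewrite /zn valZN; have := ltZ x N1; case: ifP; lia. Qed.

Lemma zn_mulrn x q : (zn (x *+ q) <= q * zn x)%N.
Proof.
elim: q => [|q IH]; first by rewrite mulr0n zn0.
rewrite mulrS mulSn; apply: leq_trans (znD _ _) _; by rewrite leq_add2l.
Qed.

Lemma zn_sub_le x y : (y <= x)%N -> (zn (x - y)%R <= x - y)%N.
Proof. rewrite /zn valZD valZN; have := ltZ x N1; have := ltZ y N1; do 2![case: ifP]; lia. Qed.

(** Pigeonhole: among the multiples of [v] from 0 to [Q], two share one of the [Q] equal cells of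
    the circle, and [q] is the difference of their indices. *)
Lemma dirichlet v (Q : nat) : (0 < Q)%N ->
  exists q, [/\ (0 < q)%N, (q <= Q)%N & (Q * zn (v *+ q) <= N)%N].
Proof.
move=> Q0; have N0 : (0 < N)%N by apply: ltnW.
have cellP (i : 'I_Q.+1) : ((v *+ i)%R * Q %/ N < Q)%N.
  by rewrite ltn_divLR // mulnC ltn_pmul2l // ltZ.
pose cell i := Ordinal (cellP i).
have /injectivePn[i [j ij cij]] : ~~ injectiveb cell.
  by apply/injectiveP => /leq_card; rewrite !card_ord ltnn.
wlog lt_ij : i j ij cij / (i < j)%N.
  move=> W; have := ij; rewrite -val_eqE neq_ltn => /orP[]; last first.
    by move=> ji; apply: (W j i) => //; rewrite eq_sym.
  exact: W.
exists (j - i)%N; split; first by rewrite subn_gt0.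
  by apply: leq_trans (leq_subr _ _) _; rewrite -ltnS.
rewrite mulrnBr ?(ltnW lt_ij) //; move: cij => /(congr1 val) /=.
move: (v *+ i) (v *+ j) => a b e.
have {e} [] : (a * Q < b * Q + N /\ b * Q < a * Q + N)%N.
  have := divn_eq (a * Q) N; have := divn_eq (b * Q) N; rewrite e.
  have := ltn_pmod (a * Q) N0; have := ltn_pmod (b * Q) N0; lia.
have [ab|ba] := leqP a b.
  move=> _ h; have := leq_mul (leqnn Q) (zn_sub_le ab) => /leq_trans; apply.
  by rewrite mulnBr; lia.
move=> h _; rewrite -znN opprB.
have := leq_mul (leqnn Q) (zn_sub_le (ltnW ba)) => /leq_trans; apply.
by rewrite mulnBr; lia.
Qed.

End Zn.

Section PrimeModulus.
Variable N : nat.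
Hypothesis Np : prime N.
Let N1 : (1 < N)%N := prime_gt1 Np.

Lemma mulZ_neq0 (x y : 'Z_N) : x != 0 -> y != 0 -> x * y != 0.
Proof.
rewrite -!val_eqE /= => x0 y0; rewrite [in X in (_ %% X)%N]Zp_cast //.
rewrite -/(dvdn _ _) Euclid_dvdM // negb_or.
by rewrite !gtnNdvd ?lt0n // ltZ.
Qed.

Lemma mulZI (x : 'Z_N) : x != 0 -> injective ( *%R x).
Proof.
move=> x0 y z /eqP; rewrite -subr_eq0 -mulrBr => yz; apply/eqP; rewrite -subr_eq0.
by apply: contraLR yz; exact: mulZ_neq0.
Qed.

Lemma natrZ_neq0 (q : nat) : (0 < q < N)%N -> (q%:R : 'Z_N) != 0.
Proof.
by move=> /andP[q0 qN]; rewrite -val_eqE /= val_Zp_nat // modn_small // -lt0n.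
Qed.

Lemma mulZn_neq0 (x : 'Z_N) (q : nat) : x != 0 -> (0 < q < N)%N -> x *+ q != 0.
Proof. by move=> x0 qN; rewrite -mulr_natr mulZ_neq0 ?natrZ_neq0. Qed.

Lemma doubleZ_inj : (2 < N)%N -> injective (fun x : 'Z_N => x + x).
Proof.
move=> N2 x y xy; have n2 : (2%:R : 'Z_N) != 0 by exact: natrZ_neq0.
by apply: (mulZI n2); rewrite !mulr_natl !mulr2n.
Qed.

End PrimeModulus.

(** * Cuts and 3-term progressions *)

Lemma card_pairs (G : finType) (A : {set G}) (Z : G -> {set G}) :
  #|[set q : G * G | (q.1 \in A) && (q.2 \in Z q.1)]| = (\sum_(r in A) #|Z r|)%N.
Proof.
rewrite -sum1_card (partition_big fst (mem A)) /=; last by move=> q; rewrite inE => /andP[].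
apply: eq_bigr => r rA; rewrite sum1dep_card.
rewrite -(card_imset (Z r) (f := fun z => (r, z))); last by move=> z z' [].
apply: eq_card => -[q1 q2]; rewrite !inE /=; apply/andP/imsetP => [[/andP[_ qZ] /eqP q1r]|[z zZ [-> ->]]].
  by exists q2; rewrite -q1r.
by rewrite rA zZ eqxx.
Qed.

Section ThreeAP.
Variable G : finZmodType.
Implicit Types (A X : {set G}) (p : G * G).

Definition mid3 p := p.1 + p.2.
Definition last3 p := p.1 + p.2 + p.2.

Definition ap3 A : {set G * G} :=
  [set p | [&& p.1 \in A, mid3 p \in A & last3 p \in A]].

Definition mixed3 A X : {set G * G} :=
  [set p in ap3 A | ~~ (((p.1 \in X) == (mid3 p \in X)) && ((mid3 p \in X) == (last3 p \in X)))].

(** An expansion condition: up to the factor [D], a cut is crossed by as many progressions as it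
    separates pairs. *)
Definition connected3 (D : nat) A :=
  forall X, X \subset A -> (#|X| * #|A :\: X| <= D * #|mixed3 A X|)%N.

(** With [r] as one end of a progression, [z] is its middle and the other end is in [X]; in
    [reflect_in], [z] is the other end and the middle is in [X]. *)
Definition reflect_out A X r : {set G} := [set z in A :\: X | z + z - r \in X].
Definition reflect_in A X r : {set G} := [set z in A :\: X | [exists p in X, z + r == p + p]].

Lemma card_fiber_le (S : {set G * G}) (A : {set G}) (Z : G -> {set G}) (h : G * G -> G * G) :
  injective h -> (forall p, p \in S -> (h p).1 \in A /\ (h p).2 \in Z (h p).1) ->
  (#|S| <= \sum_(r in A) #|Z r|)%N.
Proof.
move=> h_inj hS; rewrite -(card_imset S h_inj).
pose U := [set q : G * G | (q.1 \in A) && (q.2 \in Z q.1)].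
apply: leq_trans (_ : #|U| <= _)%N.
  apply/subset_leq_card/subsetP => _ /imsetP[p pS ->]; rewrite inE; apply/andP; exact: hS.
by rewrite card_pairs.
Qed.

Hypothesis dbl_inj : injective (fun x : G => x + x).

Lemma ends_inj : injective (fun p => (last3 p, p.1)).
Proof.
move=> [a b] [c d] [] /= + ac; rewrite /last3 /= ac -!addrA => /addrI /dbl_inj ->//.
Qed.

Lemma ends_inj' : injective (fun p => (p.1, last3 p)).
Proof. by move=> p q [e1 e2]; apply: ends_inj; rewrite e1 e2. Qed.

Lemma ap3_ends3 (A : {set G}) : (#|ap3 A| <= \sum_(x in A) \sum_(y in A) ends3 A x y)%N.
Proof.
apply: leq_trans (card_fiber_le (A := A) (Z := fun x => [set y in A | ends3 A x y]) ends_inj' _) _.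
  move=> p; rewrite !inE => /and3P[p1 p2 p3] /=; rewrite p1 p3; split=> //=.
  by apply/exists_inP; exists (mid3 p) => //; rewrite /last3 /mid3 -!addrA addrCA.
apply: leq_sum => x _; rewrite -sum1_card [leqRHS]big_mkcond [leqLHS]big_mkcond /=.
by apply: leq_sum => y _; rewrite inE; case: (y \in A); case: (ends3 A x y).
Qed.

(** Some end of a mixed progression is on the other side of the cut from the middle. Taking the
    opposite end as [r], whichever of these two terms is outside [X] lies in a reflection; the two
    choices of the end give the factor 2. *)
Lemma mixed3_le A X :
  (#|mixed3 A X| <= 2 * \sum_(r in A) (#|reflect_out A X r| + #|reflect_in A X r|))%N.
Proof.
pose S1 := [set p in mixed3 A X | (mid3 p \in X) && (p.1 \notin X)].
pose S2 := [set p in mixed3 A X | (mid3 p \in X) && (last3 p \notin X)].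
pose S3 := [set p in mixed3 A X | (mid3 p \notin X) && (p.1 \in X)].
pose S4 := [set p in mixed3 A X | (mid3 p \notin X) && (last3 p \in X)].
have sub : mixed3 A X \subset S1 :|: S2 :|: (S3 :|: S4).
  apply/subsetP => p pM; have := pM; rewrite inE => /andP[_].
  rewrite /S1 /S2 /S3 /S4; move: (mixed3 A X) pM => M pM; rewrite !inE pM.
  by case: (p.1 \in X); case: (mid3 p \in X); case: (last3 p \in X).
have h1 : (#|S1| <= \sum_(r in A) #|reflect_in A X r|)%N.
  apply: card_fiber_le ends_inj _ => p; rewrite !inE /= => /andP[/andP[/and3P[p1 _ p3] _] /andP[m1 ->]].
  by rewrite p1; split=> //; apply/exists_inP; exists (mid3 p) => //; rewrite /last3 /mid3 -!addrA addrCA.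
have h2 : (#|S2| <= \sum_(r in A) #|reflect_in A X r|)%N.
  apply: card_fiber_le ends_inj' _ => p; rewrite !inE /= => /andP[/andP[/and3P[p1 _ p3] _] /andP[m1 ->]].
  by rewrite p3; split=> //; apply/exists_inP; exists (mid3 p) => //; rewrite addrC /last3 /mid3 -!addrA addrCA.
have h3 : (#|S3| <= \sum_(r in A) #|reflect_out A X r|)%N.
  apply: (@card_fiber_le _ _ _ (fun p => (last3 p, mid3 p))).
    move=> [a b] [c d] [] /=; rewrite /last3 /mid3 /= => + e; rewrite e => /addrI bd.
    by move: e; rewrite bd => /addIr ->.
  move=> p; rewrite !inE /= => /andP[/andP[/and3P[p1 p2 p3] _] /andP[m1 m2]].
  rewrite p2 p3 m1; split=> //=; move: m2; congr (_ \in X).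
  by rewrite /last3 /mid3; rewrite opprD addrA -[_ - (p.1 + p.2)]addrA subrr addr0 addrK.
have h4 : (#|S4| <= \sum_(r in A) #|reflect_out A X r|)%N.
  apply: (@card_fiber_le _ _ _ (fun p => (p.1, mid3 p))).
    by move=> [a b] [c d] [] /=; rewrite /mid3 /= => -> /addrI ->.
  move=> p; rewrite !inE /= => /andP[/andP[/and3P[p1 p2 p3] _] /andP[m1 m2]].
  rewrite p2 p1 m1; split=> //=; move: m2; congr (_ \in X).
  by apply: (addIr p.1); rewrite /last3 /mid3 subrK -!addrA [p.2 + p.1]addrC.
apply: leq_trans (subset_leq_card sub) _; rewrite big_split /=.
have h12 := leq_trans (leq_card_setU S1 S2).1 (leq_add h1 h2).
have h34 := leq_trans (leq_card_setU S3 S4).1 (leq_add h3 h4).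
apply: leq_trans (leq_card_setU _ _).1 _; apply: leq_trans (leq_add h12 h34) _.
by rewrite !addnn -doubleD mul2n addnC.
Qed.

(* [r] being fixed, both reflections make [Z] an affine image of a part of [X]. *)
Lemma affine_neighbours A X : (0 < #|A|)%N -> exists2 r, r \in A &
  exists Z : {set G}, [/\ Z = reflect_out A X r \/ Z = reflect_in A X r, Z \subset A :\: X
     & (#|mixed3 A X| <= 4 * #|A| * #|Z|)%N].
Proof.
move=> A0; pose m r := maxn #|reflect_out A X r| #|reflect_in A X r|.
have [r0 r0A] := card_gt0P A0.
have [r rA rmax] := arg_maxnP m r0A.
exists r => //.
have le : (#|mixed3 A X| <= 4 * #|A| * m r)%N.
  apply: leq_trans (mixed3_le A X) _.
  apply: (@leq_trans (2 * \sum_(s in A) (m r + m r)))%N.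
    rewrite leq_mul2l /=; apply: leq_sum => s /rmax; rewrite /m /=; lia.
  by rewrite sum_nat_const; nia.
have [le_oi|/ltnW le_io] := leqP #|reflect_out A X r| #|reflect_in A X r|.
  exists (reflect_in A X r); split; [by right| |].
    by apply/subsetP => z; rewrite inE => /andP[].
  by move: le; rewrite /m (maxn_idPr le_oi).
exists (reflect_out A X r); split; [by left| |].
  by apply/subsetP => z; rewrite inE => /andP[].
by move: le; rewrite /m (maxn_idPl le_io).
Qed.

End ThreeAP.

(** * Short arcs and the growth of the captured part *)

Section Step.
Variables (R : realType) (N : nat).
Hypothesis Np : prime N.
Hypothesis N2 : (2 < N)%N.
Let N1 : (1 < N)%N := prime_gt1 Np.
Implicit Types (A X Z : {set 'Z_N}) (l u : 'Z_N) (b : R).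

Definition in_arc l u b X := forall x, x \in X -> (zn (l * x - u))%:R <= b.

Lemma in_arc_mulrn l u b X q : in_arc l u b X -> in_arc (l *+ q) (u *+ q) (q%:R * b) X.
Proof.
move=> hX x /hX hx; rewrite [l *+ q * x]mulrnAl -mulrnBl.
apply: (@le_trans _ _ (q%:R * (zn (l * x - u))%:R)); last by rewrite ler_wpM2l.
by rewrite -natrM ler_nat zn_mulrn.
Qed.

Lemma in_arc_shift l u u' b b' X : in_arc l u b X -> (zn (u - u'))%:R <= b' -> in_arc l u' (b + b') X.
Proof.
move=> hX ub x /hX hx; have -> : l * x - u' = (l * x - u) + (u - u') by rewrite addrA subrK.
by apply: le_trans (lerD hx ub); rewrite -natrD ler_nat znD.
Qed.

Lemma in_arc_le l u b b' X : b <= b' -> in_arc l u b X -> in_arc l u b' X.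
Proof. by move=> bb hX x /hX /le_trans; apply. Qed.

(** Multiplying by Dirichlet's [q] for [u' - u] brings the two centres within [N / Q] of each other
    and widens the arcs by a factor at most [Q]. *)
Lemma merge_arcs l u u' b X Z (Q : nat) : l != 0 -> (0 < Q < N)%N -> 0 <= b ->
  in_arc l u b X -> in_arc l u' b Z ->
  exists l1 u1, l1 != 0 /\ in_arc l1 u1 (Q%:R * b + N%:R / Q%:R) (X :|: Z).
Proof.
move=> l0 /andP[Q0 QN] b0 hX hZ; have [q [q0 qQ qu]] := dirichlet N1 (u' - u) Q0.
have Q0R : 0 < Q%:R :> R by rewrite ltr0n.
exists (l *+ q), (u *+ q); split; first by rewrite mulZn_neq0 // q0 (leq_ltn_trans qQ).
have qb : q%:R * b <= Q%:R * b by rewrite ler_wpM2r // ler_nat.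
have NQ : 0 <= N%:R / Q%:R :> R by rewrite divr_ge0.
move=> x /setUP[xX|xZ].
  by apply: (in_arc_le _ (in_arc_mulrn q hX)) => //; lra.
apply: (in_arc_le _ (in_arc_shift (u' := u *+ q) (in_arc_mulrn q hZ) (lexx _))) => //.
by rewrite -mulrnBl lerD // ler_pdivlMr // -natrM ler_nat mulnC.
Qed.

(** The frequency is doubled because [reflect_out] controls only [z + z]; at this frequency,
    [z = p + p - r] in [reflect_in] quadruples the radius. *)
Lemma affine_arc l u b A X r Z : 0 <= b -> in_arc l u b X ->
  Z = reflect_out A X r \/ Z = reflect_in A X r ->
  exists u1 u2, in_arc (l *+ 2) u1 (4 * b) X /\ in_arc (l *+ 2) u2 (4 * b) Z.
Proof.
move=> b0 hX hZ; exists (u *+ 2).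
have X2 : in_arc (l *+ 2) (u *+ 2) (4 * b) X.
  by apply: (in_arc_le _ (in_arc_mulrn 2 hX)); lra.
case: hZ => ->.
  exists (u + l * r); split=> // z; rewrite inE => /andP[_ /hX].
  rewrite (_ : l *+ 2 * z - (u + l * r) = l * (z + z - r) - u); last by rewrite mulr2n; ring.
  by move/le_trans; apply; lra.
exists (u *+ 4 - l * r *+ 2); split=> // z; rewrite inE => /andP[_ /exists_inP[p pX /eqP zr]].
have -> : l *+ 2 * z - (u *+ 4 - l * r *+ 2) = (l *+ 4) * p - u *+ 4.
  by rewrite -(addrK r z) zr; ring.
exact: (in_arc_mulrn 4 hX).
Qed.

End Step.

(** [al] is the proportion reached so far, and the second alternative ends the process. [eta] is
    quantified inside, so that a round can ask the previous one for a much shorter arc. *)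
Definition concentrates (R : realType) (D : nat) (eps al : R) : Prop :=
  forall eta : R, 0 < eta -> exists2 c : R, 0 < c &
  forall (N : nat) (A : {set 'Z_N}), prime N -> (2 < N)%N -> (0 < #|A|)%N ->
  #|A|%:R <= c * N%:R -> connected3 D A -> (#|A| ^ 2 <= D * #|ap3 A|)%N ->
  exists (l u : 'Z_N) (X : {set 'Z_N}),
    [/\ l != 0, X \subset A, in_arc l u (eta * N%:R) X
      & al * #|A|%:R <= #|X|%:R \/ (1 - eps) * #|A|%:R <= #|X|%:R].

Lemma concentrates_start (R : realType) (D : nat) (eps : R) : (0 < D)%N ->
  exists2 d : R, 0 < d & concentrates D eps d.
Proof.
move=> D0; have [d d0 hd] := @concentration R D D0; exists d => // eta eta0.
have [c c0 hc] := hd eta eta0; exists c => // N A Np N2 A0 Ac _ hT.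
have [|l [u [l0 lX]]] := hc N A (prime_gt1 Np) A0 Ac.
  have := leq_trans hT (leq_mul (leqnn D) (ap3_ends3 (doubleZ_inj Np N2) A)).
  rewrite -(ler_nat R) natrX natrM natr_sum => /le_trans; apply.
  by rewrite ler_wpM2l //; apply: ler_sum => x _; rewrite natr_sum.
exists l, u, [set x in A | (zn (l * x - u))%:R <= eta * N%:R]; split=> //; last by left.
  by apply/subsetP => x; rewrite inE => /andP[].
by move=> x; rewrite inE => /andP[].
Qed.

(** If more than [eps * #|A|] points are missing, connectedness and [affine_neighbours] supply at
    least [al0 * eps * #|A| / (4 * D)] of them. [al0] stays fixed so that all rounds gain the same
    amount. *)
Lemma concentrates_step (R : realType) (D : nat) (eps al0 al : R) :
  (0 < D)%N -> 0 < eps -> 0 < al0 -> al0 <= al -> concentrates D eps al ->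
  concentrates D eps (al + al0 * eps / (4 * D%:R)).
Proof.
move=> D0 eps0 al00 al0_le hal eta eta0.
have D0R : 0 < D%:R :> R by rewrite ltr0n.
pose Q := Num.bound (2 / eta).
have Qeta : 2 / eta < Q%:R by rewrite archi_boundP // divr_ge0 // ltW.
have Q0R : 0 < Q%:R :> R by apply: le_lt_trans Qeta; rewrite divr_ge0 // ltW.
have Q0 : (0 < Q)%N by rewrite -(ltr_nat R).
(* The radius grows by 4 in [affine_arc] and by [Q] in [merge_arcs], which makes it [eta / 2] times
   [N]; the error [N / Q] takes the other half. *)
pose eta1 := eta / (8 * Q%:R).
have eta1_0 : 0 < eta1 by rewrite divr_gt0 // mulr_gt0.
have Qinv : Q%:R^-1 <= eta / 2.
  by rewrite -div1r ler_pdivrMr // mulrAC ler_pdivlMr // mul1r mulrC -ler_pdivrMr // ltW.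
have [c c0 hc] := hal eta1 eta1_0.
(* As [A] is nonempty, density at most [(Q.+1)%:R^-1] forces [Q < N]. *)
exists (Num.min c (Q.+1)%:R^-1) => [|N A Np N2 A0 Ac hconn hT]; first by rewrite lt_min c0 invr_gt0 ltr0n.
have N0 : 0 < N%:R :> R by rewrite ltr0n ltnW // ltnW.
have n0 : 0 < #|A|%:R :> R by rewrite ltr0n.
have n1 : 1 <= #|A|%:R :> R by rewrite ler1n.
have QN : (0 < Q < N)%N.
  rewrite Q0 /= -(ler_nat R).
  have : #|A|%:R <= (Q.+1)%:R^-1 * N%:R :> R.
    by apply: le_trans Ac _; rewrite ler_wpM2r ?(ltW N0) // ge_min lexx orbT.
  by rewrite mulrC ler_pdivlMr ?ltr0n // => /(le_trans _); apply; rewrite ler_peMl.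
have [|l [u [X [l0 sXA hX hal2]]]] := hc N A Np N2 A0 _ hconn hT.
  by apply: le_trans Ac _; rewrite ler_wpM2r // ?ge_min ?lexx // ltW.
have eta1_le : eta1 * N%:R <= eta * N%:R.
  rewrite ler_pM2r // ler_pdivrMr ?mulr_gt0 // ler_peMr ?(ltW eta0) //.
  have : 1 <= Q%:R :> R by rewrite ler1n.
  by clear; lra.
have done : (1 - eps) * #|A|%:R <= #|X|%:R ->
    exists (l u : 'Z_N) (X : {set 'Z_N}), [/\ l != 0, X \subset A, in_arc l u (eta * N%:R) X
      & (al + al0 * eps / (4 * D%:R)) * #|A|%:R <= #|X|%:R \/ (1 - eps) * #|A|%:R <= #|X|%:R].
  by move=> hX1; exists l, u, X; split=> //; [exact: in_arc_le hX | right].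
case: hal2 => // hal2.
have cA : #|A|%:R = #|X|%:R + #|A :\: X|%:R :> R.
  by rewrite -natrD -(cardsID X A) (setIidPr sXA).
have [small|big] := lerP #|A :\: X|%:R (eps * #|A|%:R).
  by apply: done; move: cA small; clear; lra.
have [r rA [Z [hZ sZ cZ]]] := affine_neighbours (doubleZ_inj Np N2) X A0.
have b0 : 0 <= eta1 * N%:R by rewrite mulr_ge0 // ltW.
have [u1 [u2 [hX2 hZ2]]] := affine_arc Np b0 hX hZ.
have l2 : l *+ 2 != 0 by rewrite mulZn_neq0.
have b4 : 0 <= 4 * (eta1 * N%:R) by rewrite mulr_ge0.
have [l1 [v [l10 hXZ]]] := merge_arcs Np l2 QN b4 hX2 hZ2.
exists l1, v, (X :|: Z); split => //.
- by rewrite subUset sXA (subset_trans sZ) // subsetDl.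
- apply: in_arc_le hXZ.
  have -> : Q%:R * (4 * (eta1 * N%:R)) = eta / 2 * N%:R.
    by rewrite /eta1; field; rewrite gt_eqF.
  have : N%:R / Q%:R <= eta / 2 * N%:R by rewrite [leLHS]mulrC ler_pM2r.
  by clear; lra.
left.
have -> : #|X :|: Z|%:R = #|X|%:R + #|Z|%:R :> R.
  rewrite -natrD cardsU (_ : X :&: Z = set0) ?cards0 ?subn0 //.
  apply/eqP; rewrite -subset0; apply/subsetP => z /setIP[zX /(subsetP sZ)].
  by rewrite inE zX.
rewrite mulrDl lerD // mulrAC ler_pdivrMr ?mulr_gt0 // -(ler_pM2r n0).
have h1 : #|X|%:R * #|A :\: X|%:R <= D%:R * (4 * #|A|%:R * #|Z|%:R) :> R.
  rewrite -!natrM ler_nat; apply: leq_trans (hconn X sXA) _.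
  by rewrite leq_mul2l cZ orbT.
have h2 : al0 * #|A|%:R * (eps * #|A|%:R) <= #|X|%:R * #|A :\: X|%:R.
  apply: ler_pM; rewrite ?mulr_ge0 ?(ltW al00) ?(ltW eps0) //; last exact: ltW.
  by apply: le_trans hal2; rewrite ler_wpM2r.
move: (le_trans h2 h1); clear; lra.
Qed.

Lemma concentrates_all (R : realType) (D : nat) (eps : R) : (0 < D)%N -> 0 < eps ->
  forall eta : R, 0 < eta -> exists2 c : R, 0 < c &
  forall (N : nat) (A : {set 'Z_N}), prime N -> (2 < N)%N -> (0 < #|A|)%N ->
  #|A|%:R <= c * N%:R -> connected3 D A -> (#|A| ^ 2 <= D * #|ap3 A|)%N ->
  exists (l u : 'Z_N) (X : {set 'Z_N}),
    [/\ l != 0, X \subset A, in_arc l u (eta * N%:R) X & (1 - eps) * #|A|%:R <= #|X|%:R].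
Proof.
move=> D0 eps0; have [d d0 hd] := @concentrates_start R D eps D0.
pose g := d * eps / (4 * D%:R).
have g0 : 0 < g by rewrite divr_gt0 ?mulr_gt0 ?ltr0n.
have iter_hd j : concentrates D eps (d + g *+ j).
  elim: j => [|j IH]; first by rewrite mulr0n addr0.
  rewrite mulrSr addrA; apply: concentrates_step => //.
  by rewrite lerDl mulrn_wge0 // ltW.
(* After [j] gains the proportion is at least 1, so the first alternative implies the second. *)
pose j := Num.bound g^-1.
have hj : 1 <= d + g *+ j.
  have : g^-1 < j%:R by rewrite archi_boundP // invr_ge0 ltW.
  rewrite -(ltr_pM2l g0) divff ?gt_eqF // mulr_natr; move: d0; clear; lra.
move=> eta eta0; have [c c0 hc] := iter_hd j eta eta0.
exists c => // N A Np N2 A0 Ac hconn hT.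
have [l [u [X [l0 sXA hX []hal]]]] := hc N A Np N2 A0 Ac hconn hT; exists l, u, X; split=> //.
apply: le_trans hal; rewrite ler_wpM2r //; move: eps0 hj; clear; lra.
Qed.

(* [Z] stands for the graph of a partial bijection of [A] that sends no point of [X] into [X]. *)
Lemma card_avoiding (G : finType) (A X : {set G}) (Z : G -> {set G}) :
  (forall r, Z r \subset A) ->
  (forall r s z, z \in Z r -> z \in Z s -> r = s) ->
  (forall r z w, z \in Z r -> w \in Z r -> z = w) ->
  (forall r z, r \in X -> z \in X -> z \notin Z r) ->
  (\sum_(r in A) #|Z r| <= 2 * #|A :\: X|)%N.
Proof.
move=> ZA injl injr avoid; rewrite -card_pairs; set W := [set q | _].
pose W1 := [set q in W | q.1 \notin X]; pose W2 := [set q in W | q.2 \notin X].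
have sub : W \subset W1 :|: W2.
  apply/subsetP => q; rewrite !inE => /andP[q1 q2]; rewrite q1 q2 /= -negb_and; apply/negP => /andP[x1 x2].
  by have := avoid _ _ x1 x2; rewrite q2.
apply: leq_trans (subset_leq_card sub) _; apply: leq_trans (leq_card_setU _ _).1 _.
rewrite mul2n -addnn; apply: leq_add.
  rewrite -(card_in_imset (f := fst) (D := W1)).
    apply/subset_leq_card/subsetP => _ /imsetP[q + ->]; rewrite !inE.
    by move=> /andP[/andP[-> _] ->].
  move=> [a b] [c d]; rewrite !inE /= => /andP[/andP[_ h1] _] /andP[/andP[_ h2] _] ac.
  by move: h2; rewrite -ac => /(injr _ _ _ h1) ->.
rewrite -(card_in_imset (f := snd) (D := W2)).
  apply/subset_leq_card/subsetP => _ /imsetP[q + ->]; rewrite !inE.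
  by move=> /andP[/andP[_ /(subsetP (ZA _)) ->] ->].
move=> [a b] [c d]; rewrite !inE /= => /andP[/andP[_ h1] _] /andP[/andP[_ h2] _] bd.
by move: h2; rewrite -bd => /(injl _ _ _ h1) ->.
Qed.

(** Otherwise no progression through [x] has its other two terms in [X], so at most [8 * #|A :\: X|]
    progressions cross the cut [[set x]], too few for connectedness. The constant 17 makes
    [8 * #|A| / 17 < #|A| - 1] from [#|A| = 2] on. *)
Lemma point_near (G : finZmodType) (D : nat) (A X : {set G}) (x : G) :
  injective (fun x : G => x + x) -> x \in A -> (0 < D)%N -> (1 < #|A|)%N ->
  (17 * D * #|A :\: X| <= #|A|)%N -> connected3 D A ->
  exists r z, [/\ r \in X, z \in X & x = z + z - r \/ x + x = z + r].
Proof.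
move=> dbl xA D0 n1 small hconn.
have [/existsP[r /existsP[z /and3P[rX zX /orP h]]]|] :=
  boolP [exists r, exists z, [&& r \in X, z \in X & (x == z + z - r) || (x + x == z + r)]].
  by exists r, z; split=> //; case: h => /eqP; [left|right].
rewrite negb_exists => /forallP none; exfalso.
have none' r z : r \in X -> z \in X -> (x != z + z - r) && (x + x != z + r).
  move=> rX zX; have := none r; rewrite negb_exists => /forallP/(_ z).
  by rewrite rX zX /= negb_or.
have out : (\sum_(r in A) #|reflect_out A [set x] r| <= 2 * #|A :\: X|)%N.
  apply: card_avoiding => [r|r s z|r z w|r z rX zX].
  - by apply/subsetP => z; rewrite !inE => /andP[/andP[]].
  - rewrite !inE => /andP[_ /eqP e1] /andP[_ /eqP e2].
    by apply: (oppr_inj); apply: (addrI (z + z)); rewrite e1 e2.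
  - rewrite !inE => /andP[_ /eqP e1] /andP[_ /eqP e2].
    by apply: dbl; apply: (addIr (- r)); rewrite e1 e2.
  - by rewrite !inE; have /andP[/negPf xzr _] := none' r z rX zX; rewrite [z + z - r == x]eq_sym xzr andbF.
have inn : (\sum_(r in A) #|reflect_in A [set x] r| <= 2 * #|A :\: X|)%N.
  have inE' r z : z \in reflect_in A [set x] r -> z \in A /\ z + r = x + x.
    by rewrite !inE => /andP[/andP[_ zA] /exists_inP[p /set1P -> /eqP]].
  apply: card_avoiding => [r|r s z|r z w|r z rX zX].
  - by apply/subsetP => z /inE'[].
  - by move=> /inE'[_ e1] /inE'[_ e2]; apply: (addrI z); rewrite e1 e2.
  - by move=> /inE'[_ e1] /inE'[_ e2]; apply: (addIr r); rewrite e1 e2.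
  - apply/negP => /inE'[_ e].
    by have /andP[_] := none' r z rX zX; rewrite e eqxx.
have := hconn [set x]; rewrite sub1set => /(_ xA).
have := cardsD1 x A; rewrite xA cards1 => cA.
have := mixed3_le dbl A [set x]; rewrite big_split /= => m1.
have m2 : (#|mixed3 A [set x]| <= 8 * #|A :\: X|)%N.
  by apply: leq_trans m1 _; move: out inn; set a := (\sum_(r in A) _)%N; set b := (\sum_(r in A) _)%N; lia.
rewrite mul1n => h; have := leq_trans h (leq_mul (leqnn D) m2).
move: cA small n1; rewrite -mulnA mulnCA; set k := #|A :\: [set x]|; set w := (D * _)%N; lia.
Qed.

Lemma rectify (R : realType) (D : nat) : (0 < D)%N ->
  exists2 c : R, 0 < c & forall (N : nat) (A : {set 'Z_N}), prime N -> (2 < N)%N ->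
  #|A|%:R <= c * N%:R -> connected3 D A -> (#|A| ^ 2 <= D * #|ap3 A|)%N ->
  exists l u : 'Z_N, l != 0 /\ forall x, x \in A -> (4 * zn (l * x - u)%R < N)%N.
Proof.
move=> D0.
have D0R : 0 < D%:R :> R by rewrite ltr0n.
have eps0 : 0 < (17 * D%:R)^-1 :> R by rewrite invr_gt0 mulr_gt0.
(* In the worst case [x = z + z - r], the doubled dilate has radius [(4 + 2) * N / 48 = N / 8]. *)
have eta0 : 0 < 48^-1 :> R by rewrite invr_gt0.
have [c c0 hc] := concentrates_all D0 eps0 eta0.
exists c => // N A Np N2 Ac hconn hT; have N1 := prime_gt1 Np.
have [A0|A0] := posnP #|A|.
  exists 1, 0; split=> [|x]; last by rewrite (cards0_eq A0) inE.
  by rewrite -[1]/(1%:R) natrZ_neq0.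
have [l [u [X [l0 sXA hX cX]]]] := hc N A Np N2 A0 Ac hconn hT.
have N0 : 0 < N%:R :> R by rewrite ltr0n ltnW // ltnW.
have l2 : l *+ 2 != 0 by rewrite mulZn_neq0.
(* The dilate is doubled because one case of [point_near] expresses only [x + x] through points of
   [X]. *)
suff key : in_arc (l *+ 2) (u *+ 2) (8^-1 * N%:R : R) A.
  exists (l *+ 2), (u *+ 2); split=> // x /key.
  rewrite ler_pdivlMl // -natrM ler_nat => h.
  move: h N2; move: (zn _) => w; clear; lia.
have X6 : in_arc (l *+ 2) (u *+ 2) (8^-1 * N%:R : R) X.
  by apply: (in_arc_le _ (in_arc_mulrn Np 2 hX)); move: N0; lra.
have small : (17 * D * #|A :\: X| <= #|A|)%N.
  rewrite -(ler_nat R) !natrM.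
  have cA : #|A|%:R = #|X|%:R + #|A :\: X|%:R :> R.
    by rewrite -natrD -(cardsID X A) (setIidPr sXA).
  rewrite mulrC -ler_pdivlMr ?mulr_gt0 // mulrC.
  by move: cX cA; clear; lra.
move=> x xA; have [xX|xX] := boolP (x \in X); first exact: X6.
have n1 : (1 < #|A|)%N.
  have k0 : (0 < #|A :\: X|)%N by apply/card_gt0P; exists x; rewrite inE xX.
  by apply: leq_trans small; rewrite -mulnA (leq_trans _ (leq_pmulr _ _)) // muln_gt0 D0.
have [r [z [rX zX h]]] := point_near (doubleZ_inj Np N2) xA D0 n1 small hconn.
have hr := hX r rX; have hz := hX z zX.
case: h => h.
  have -> : l *+ 2 * x - u *+ 2 = (l * z - u) *+ 4 - (l * r - u) *+ 2 by rewrite h; ring.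
  have : (zn ((l * z - u) *+ 4 - (l * r - u) *+ 2)%R <= 4 * zn (l * z - u)%R + 2 * zn (l * r - u)%R)%N.
    apply: leq_trans (znD N1 _ _) _; rewrite znN //; apply: leq_add; exact: zn_mulrn.
  rewrite -(ler_nat R) natrD !natrM => /le_trans; apply; move: hr hz; clear; lra.
have -> : l *+ 2 * x - u *+ 2 = (l * z - u) + (l * r - u).
  have -> : l *+ 2 * x = l * (x + x) by rewrite mulr2n; ring.
  by rewrite h; ring.
have := znD N1 (l * z - u) (l * r - u).
rewrite -(ler_nat R) natrD => /le_trans; apply; move: hr hz N0; clear; lra.
Qed.

(** * The integer case *)

Lemma in_kAP (G : zmodType) (k : nat) (A : {fset G}) (p : G * G) : (1 < k)%N ->
  reflect (forall i : nat, (i < k)%N -> p.1 + p.2 *+ i \in A) (p \in fset_set (kAP k A)).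
Proof.
move=> k1; rewrite in_fset_set; last exact: finite_kAP.
by apply: (iffP idP) => [/set_mem|h]; [|apply/mem_set].
Qed.

Lemma numAP_le_size (G : zmodType) (T : eqType) (k : nat) (A : {fset G}) (s : seq T) (phi : G * G -> T) :
  (1 < k)%N ->
  (forall p, (forall i : nat, (i < k)%N -> p.1 + p.2 *+ i \in A) -> phi p \in s) ->
  (forall p q, (forall i : nat, (i < k)%N -> p.1 + p.2 *+ i \in A) ->
     (forall i : nat, (i < k)%N -> q.1 + q.2 *+ i \in A) -> phi p = phi q -> p = q) ->
  (numAP k A <= size s)%N.
Proof.
move=> k1 hs hinj; rewrite /numAP -(size_map phi).
apply: uniq_leq_size.
  rewrite map_inj_in_uniq ?fset_uniq // => p q /(in_kAP _ _ k1) hp /(in_kAP _ _ k1) hq; exact: hinj.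
by move=> _ /mapP[p /(in_kAP _ _ k1) hp ->]; exact: hs.
Qed.

Lemma size_le_numAP (G : zmodType) (T : eqType) (k : nat) (A : {fset G}) (s : seq T) (psi : T -> G * G) :
  (1 < k)%N -> uniq s ->
  (forall t, t \in s -> forall i : nat, (i < k)%N -> (psi t).1 + (psi t).2 *+ i \in A) ->
  {in s &, injective psi} -> (size s <= numAP k A)%N.
Proof.
move=> k1 us hs hinj; rewrite /numAP -(size_map psi s).
apply: uniq_leq_size; first by rewrite map_inj_in_uniq.
by move=> _ /mapP[t ts ->]; apply/(in_kAP _ _ k1); exact: hs.
Qed.

(** The least [i] with [F i.+1 <= i] satisfies [i <= F i] by minimality, and monotonicity closes the
    chain [i <= F i <= F i.+1 <= i]. *)
Lemma discrete_fixpoint (q : nat) (F : nat -> nat) : (0 < q)%N ->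
  (forall i, (i < q)%N -> (F i <= F i.+1)%N) -> (forall i, (i <= q)%N -> (F i < q)%N) ->
  exists i, [/\ (i < q)%N, F i = i & F i.+1 = i].
Proof.
move=> q0 Fmono Flt.
have ex : exists i, (F i.+1 <= i)%N by exists q.-1; rewrite prednK // -ltnS prednK // Flt.
case: (ex_minnP ex) => i Fi min_i.
have iq : (i < q)%N.
  rewrite -(prednK q0) ltnS min_i // prednK // -ltnS prednK // Flt //.
have iF : (i <= F i)%N.
  by case: i Fi min_i iq => // i _ min_i _; rewrite ltnNge; apply/negP => /min_i; rewrite ltnn.
by exists i; split=> //; have := Fmono i iq; lia.
Qed.

Section Congruent.
Variable q : nat.
Hypothesis q0 : (0 < q)%N.

(** These are the pairs of first and last terms of the progressions with [q.+1] terms in [[0,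
    n[]. *)
Definition congruent_pairs (n : nat) : seq (nat * nat) :=
  [seq p <- [seq (x, y) | x <- iota 0 n, y <- iota 0 n] | (p.1 %% q == p.2 %% q)%N].

Lemma mem_congruent_pairs n x y :
  ((x, y) \in congruent_pairs n) = [&& (x < n)%N, (y < n)%N & (x %% q == y %% q)%N].
Proof.
rewrite mem_filter /= andbC; apply/andP/and3P.
  by move=> [/allpairsP[[u v] [/= + + [-> ->]]]]; rewrite !mem_iota !add0n.
move=> [xn yn xy]; split=> //; apply/allpairsP; exists (x, y).
by rewrite !mem_iota !add0n.
Qed.

Lemma uniq_congruent_pairs n : uniq (congruent_pairs n).
Proof. by rewrite filter_uniq // allpairs_uniq ?iota_uniq // => -[? ?] [? ?] _ _ [-> ->]. Qed.

Lemma size_congruent_pairs n :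
  size (congruent_pairs n) = (\sum_(0 <= i < n) \sum_(0 <= j < n) (i %% q == j %% q))%N.
Proof.
rewrite -sum1_size big_filter big_mkcond big_allpairs /index_iota subn0 /=.
by apply: eq_bigr => i _; apply: eq_bigr => j _; case: eqP.
Qed.

Lemma count_congruent n : (\sum_(0 <= i < n) (i %% q == n %% q) = n %/ q)%N.
Proof.
suff key m r : (r < q)%N -> (\sum_(0 <= i < m * q + r) (i %% q == r) = m)%N.
  by rewrite {1}(divn_eq n q) key // ltn_pmod.
move=> rq; elim: m => [|m IH].
  rewrite mul0n big_nat_cond big1 // => i; rewrite andbT add0n => /= ir.
  by rewrite modn_small ?(ltn_trans ir) // ltn_eqF.
rewrite mulSn -addnA (@big_cat_nat _ _ _ q) ?leq_addr //=.
rewrite -[X in (_ + \sum_(X <= _ < _) _)%N]add0n big_addn addKn.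
under [X in (_ + X)%N]eq_bigr do rewrite modnDr.
rewrite IH -add1n; congr (_ + _)%N.
rewrite (big_cat_nat _ (n := r)) ?(ltnW rq) //= [X in (_ + X)%N]big_ltn // modn_small // eqxx.
rewrite big_nat_cond big1 ?add0n => [|i]; last first.
  by rewrite andbT => /andP[_ ir]; rewrite modn_small ?(ltn_trans ir) // ltn_eqF.
rewrite big_nat_cond big1 ?addn0 // => i; rewrite andbT => /andP[ri iq].
by rewrite modn_small // gtn_eqF.
Qed.

Lemma size_congruent_pairsS n :
  size (congruent_pairs n.+1) = (size (congruent_pairs n) + 1 + 2 * (n %/ q))%N.
Proof.
rewrite !size_congruent_pairs big_nat_recr //=.
under eq_bigr do rewrite big_nat_recr //=.
rewrite big_split /= big_nat_recr //= eqxx count_congruent.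
under [X in (_ + (X + _))%N]eq_bigr do rewrite eq_sym.
rewrite count_congruent; lia.
Qed.

Lemma size_congruent_pairsE n : size (congruent_pairs n) = (n + 2 * \sum_(0 <= i < n) i %/ q)%N.
Proof.
elim: n => [|n IH]; first by rewrite size_congruent_pairs !big_geq.
by rewrite size_congruent_pairsS IH big_nat_recr //=; lia.
Qed.

(** The cross term is the gain of one interval over two separate ones; it later forces many mixed
    progressions across a cut. The induction rests on the superadditivity of the integer quotient by
    [q]. *)
Lemma size_congruent_pairsD m n :
  (size (congruent_pairs m) + size (congruent_pairs n) + 2 * (m * (n %/ q))
     <= size (congruent_pairs (m + n)))%N.
Proof.
elim: m => [|m IH]; first by rewrite (_ : size (congruent_pairs 0) = 0)%N // mul0n muln0 addn0.
rewrite addSn !size_congruent_pairsS.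
have : (m %/ q + n %/ q <= (m + n) %/ q)%N.
  by rewrite leq_divRL // mulnDl leq_add // leq_trunc_div.
lia.
Qed.

End Congruent.

(* [g] is the rank in [A] followed by the enumeration of [0, n[ by increasing residue mod [q]. *)
Lemma residue_sorted_labelling (q : nat) (A : {fset int}) :
  exists g : int -> nat,
    [/\ forall a, a \in A -> (g a < #|` A|)%N, {in A &, injective g}
      & {in A &, forall a b, a <= b -> (g a %% q <= g b %% q)%N}].
Proof.
set n := #|` A|%N.
pose s := sort <=%R (enum_fset A).
pose le_mod := [rel x y : nat | (x %% q <= y %% q)%N].
pose L := sort le_mod (iota 0 n).
pose g a := nth 0%N L (index a s).
have sE a : (a \in s) = (a \in A) by rewrite mem_sort.
have size_s : size s = n by rewrite size_sort.
have size_L : size L = n by rewrite size_sort size_iota.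
have idx a : a \in A -> (index a s < n)%N by rewrite -sE -index_mem size_s.
have sorted_L : sorted le_mod L by apply: sort_sorted => x y; exact: leq_total.
have uL : uniq L by rewrite sort_uniq iota_uniq.
exists g; split.
- move=> a /idx an.
  by have : g a \in L by [rewrite mem_nth ?size_L]; rewrite mem_sort mem_iota.
- move=> a b aA bA /eqP; rewrite nth_uniq ?size_L ?idx // => /eqP ab.
  by rewrite -(nth_index 0 (_ : a \in s)) ?sE // ab nth_index ?sE.
move=> a b aA bA ab.
have le_mod_tr : transitive le_mod by move=> y x z /=; exact: leq_trans.
have le_mod_refl : reflexive le_mod by move=> x /=.
apply: (sorted_leq_nth le_mod_tr le_mod_refl 0%N sorted_L); rewrite ?inE ?size_L ?idx //.
rewrite leqNgt; apply/negP => ba.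
have sorted_s : sorted <=%R s by apply: sort_sorted; exact: le_total.
have := sorted_leq_nth le_trans lexx 0 sorted_s; move=> /(_ (index b s) (index a s)).
rewrite !inE size_s !idx // => /(_ isT isT (ltnW ba)); rewrite !nth_index ?sE // => ba'.
have abE : a = b by apply/eqP; rewrite eq_le ab ba'.
by move: ba; rewrite abE ltnn.
Qed.

Lemma mem_zinterval (n : nat) (z : int) : (z \in zinterval n) = (1 <= z <= n%:Z).
Proof.
apply/imfsetP/andP => [[i /=]|[z1 zn]]; first by rewrite mem_iota => ? ->; split; lia.
by exists `|z|%N => /=; [rewrite mem_iota; lia | lia].
Qed.

Lemma numAP_zinterval_ge (k n : nat) : (1 < k)%N ->
  (size (congruent_pairs k.-1 n) <= numAP k (zinterval n))%N.
Proof.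
move=> k1; pose q := k.-1; have q0 : (0 < q)%N by rewrite /q; lia.
have kq : k = q.+1 by rewrite /q; lia.
(* [+ 1] passes from [[0, n[] to [[n]]; the division is exact on congruent pairs, and [q] steps lead
   from the first term to the last. *)
pose psi (p : nat * nat) : int * int := (p.1%:Z + 1, ((p.2%:Z - p.1%:Z) %/ q)%Z).
have psiE x y : (x %% q == y %% q)%N -> (psi (x, y)).2 * q%:Z = y%:Z - x%:Z.
  move=> /eqP xy; rewrite /psi /= divzK //; apply/dvdzP.
  exists ((y %/ q)%:Z - (x %/ q)%:Z).
  by rewrite {1}(divn_eq y q) {1}(divn_eq x q) xy !PoszD !PoszM; ring.
apply: (size_le_numAP (psi := psi) k1 (uniq_congruent_pairs _ _)).
  move=> [x y]; rewrite mem_congruent_pairs => /and3P[xn yn /psiE].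
  rewrite /psi /=; set d := (_ %/ _)%Z => dE i; rewrite kq ltnS => iq.
  rewrite mem_zinterval -mulr_natr.
  have h1 : 0 <= d -> (d * i%:Z <= d * q%:Z) by move=> d0; rewrite ler_wpM2l // lez_nat.
  have h2 : d <= 0 -> (d * q%:Z <= d * i%:Z) by move=> d0; rewrite ler_wnM2l // lez_nat.
  have h3 : 0 <= d -> 0 <= d * i%:Z by move=> d0; rewrite mulr_ge0.
  have h4 : d <= 0 -> d * i%:Z <= 0 by move=> d0; rewrite mulr_le0_ge0.
  have -> : i%:R = i%:Z by rewrite natz.
  by case: (lerP 0 d) => [/[dup] /h1 + /h3|/ltW/[dup] /h2 + /h4]; lia.
move=> [x y] [u v]; rewrite !mem_congruent_pairs => /and3P[_ _ /psiE h1] /and3P[_ _ /psiE h2] e.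
move: h1; rewrite e h2 => h1; move: e => [xu _].
have {}xu : x = u by lia.
by congr (_, _) => //; lia.
Qed.

Lemma numAP_int_le (k : nat) (A : {fset int}) : (1 < k)%N ->
  (numAP k A <= size (congruent_pairs k.-1 #|` A|))%N.
Proof.
move=> k1; pose q := k.-1; have q0 : (0 < q)%N by rewrite /q; lia.
have kq : k = q.+1 by rewrite /q; lia.
have [g [g_lt g_inj g_mono]] := residue_sorted_labelling q A.
pose term (p : int * int) i := p.1 + p.2 *+ i.
(* For decreasing progressions the residues are read backwards. *)
pose res (p : int * int) i := if 0 <= p.2 then (g (term p i) %% q)%N else (q.-1 - g (term p i) %% q)%N.
(* At such an index two consecutive terms have labels of equal residue, so [phi] lands in the
   congruent pairs. [find] would return [q] if there were none, which [idxP] excludes by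
   [discrete_fixpoint]. *)
pose fixed p i := (res p i == i) && (res p i.+1 == i).
pose idx p := find (fixed p) (iota 0 q).
pose phi p := (g (term p (idx p)), g (term p (idx p).+1)).
pose isAP p := forall i, (i < k)%N -> term p i \in A.
have lt_mod x : (x %% q < q)%N by rewrite ltn_pmod.
have idxP p : isAP p -> [/\ (idx p < q)%N, res p (idx p) = idx p & res p (idx p).+1 = idx p].
  move=> hp; have [i [iq ri ri']] : exists i, [/\ (i < q)%N, res p i = i & res p i.+1 = i].
    apply: discrete_fixpoint => // i iq; rewrite /res; last by case: ifP => _; have := lt_mod (g (term p i)); lia.
    have hi : term p i \in A by apply: hp; lia.
    have hi' : term p i.+1 \in A by apply: hp; lia.
    have eS : term p i.+1 = term p i + p.2 by rewrite /term mulrSr addrA.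
    case: ifP => [p0|/negbT p0].
      by apply: g_mono => //; rewrite eS lerDl.
    apply: leq_sub2l; apply: g_mono => //; rewrite eS gerDl ltW // ltNge //.
  have : has (fixed p) (iota 0 q).
    by apply/hasP; exists i; [rewrite mem_iota | rewrite /fixed ri ri' !eqxx].
  move=> hh; have := nth_find 0%N hh; have := hh; rewrite has_find size_iota -/(idx p) => iq'.
  by rewrite nth_iota // add0n => /andP[/eqP e1 /eqP e2].
have modE p j : isAP p -> (j < k)%N -> res p j = idx p ->
    (g (term p j) %% q)%N = if 0 <= p.2 then idx p else (q.-1 - idx p)%N.
  by move=> hp jk; rewrite /res; case: ifP => _ <- //; have := lt_mod (g (term p j)); lia.
apply: (numAP_le_size (phi := phi) k1) => [p hp|p p' hp hp' e].
  have [iq e1 e2] := idxP p hp.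
  rewrite /phi mem_congruent_pairs !g_lt; [|by apply: hp; lia|by apply: hp; lia].
  by rewrite !modE ?eqxx //; lia.
have [iq e1 e2] := idxP p hp; have [iq' e1' e2'] := idxP p' hp'.
move: e => [eg1 eg2].
have t1 : term p (idx p) = term p' (idx p') by apply: g_inj => //; [apply: hp|apply: hp']; lia.
have t2 : term p (idx p).+1 = term p' (idx p').+1 by apply: g_inj => //; [apply: hp|apply: hp']; lia.
have bE : p.2 = p'.2.
  by move: t2; rewrite /term !mulrSr !addrA -!/(term _ _) t1 => /addrI.
(* The two recorded terms give the difference, hence the reading direction; their common residue
   then gives the index. *)
have iE : idx p = idx p'.
  have ik : (idx p < k)%N by rewrite kq ltnW.
  have ik' : (idx p' < k)%N by rewrite kq ltnW.
  have := modE p' _ hp' ik' e1'; rewrite -eg1 -bE (modE p _ hp ik e1).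
  by case: ifP => // _; lia.
move: t1; rewrite /term iE bE => /addIr aE.
by move: aE bE; case: (p) (p') => a b [c d] /= -> ->.
Qed.

Lemma numAP_zinterval (k n : nat) : (1 < k)%N ->
  numAP k (zinterval n) = size (congruent_pairs k.-1 n).
Proof.
move=> k1; apply/eqP; rewrite eqn_leq numAP_zinterval_ge // andbT.
by have := numAP_int_le (zinterval n) k1; rewrite card_zinterval.
Qed.

(** * Induction modulo a prime *)

Definition aps (G : finZmodType) (k : nat) (A : {set G}) : {set G * G} :=
  [set p | [forall i : 'I_k, p.1 + p.2 *+ i \in A]].

Lemma apsP (G : finZmodType) (k : nat) (A : {set G}) (p : G * G) :
  reflect (forall i : nat, (i < k)%N -> p.1 + p.2 *+ i \in A) (p \in aps k A).
Proof.
rewrite inE; apply: (iffP forallP) => [h i ik|h i]; last exact: h.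
exact: (h (Ordinal ik)).
Qed.

Lemma numAP_le_aps (G : finZmodType) (k : nat) (A : {fset G}) : (1 < k)%N ->
  (numAP k A <= #|aps k [set x | x \in A]|)%N.
Proof.
move=> k1; rewrite cardE; apply: (numAP_le_size (phi := id) k1) => // p hp.
by rewrite mem_enum; apply/apsP => i ik; rewrite inE hp.
Qed.

(** * Lifting from a short arc to the integers *)

Section Lift.
Variable N : nat.
Hypothesis Np : prime N.
Let N1 : (1 < N)%N := prime_gt1 Np.

Definition srep (x : 'Z_N) : int := if (x <= N - x)%N then x%:Z else x%:Z - N%:Z.

Lemma abs_srep (x : 'Z_N) : `|srep x|%N = zn x.
Proof. rewrite /srep /zn; have := ltZ x N1; case: ifP; lia. Qed.

Lemma srepK (x : 'Z_N) : (srep x)%:~R = x.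
Proof.
have xE : (x%:R : 'Z_N) = x.
  by apply: val_inj; rewrite /= val_Zp_nat // modn_small // ltZ.
have NE : (N%:R : 'Z_N) = 0 by rewrite pchar_Zp.
by rewrite /srep; case: ifP => _; rewrite ?rmorphB /= -!pmulrn ?NE ?subr0.
Qed.

Lemma intrZ_eq0 (z : int) : (`|z| < N)%N -> (z%:~R : 'Z_N) = 0 -> z = 0.
Proof.
move=> zN /eqP z0; apply/eqP; rewrite -absz_eq0; apply: contraTT z0 => za.
have := @natrZ_neq0 N Np `|z|%N; rewrite lt0n za zN => /(_ isT); apply: contraNneq => z0.
by case: z z0 {zN za} => m; rewrite ?NegzE /= ?rmorphN /= -pmulrn => /eqP; rewrite ?oppr_eq0 => /eqP ->.
Qed.

(** A second difference of three lifts is smaller than [N] in absolute value; along a progression it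
    is 0 modulo [N], hence 0. So progressions of [A] lift to integer progressions and [numAP_int_le]
    applies. *)
Lemma aps_le_of_arc (k : nat) (A : {set 'Z_N}) (l u : 'Z_N) : (1 < k)%N -> l != 0 ->
  (forall x, x \in A -> (4 * zn (l * x - u)%R < N)%N) ->
  (#|aps k A| <= size (congruent_pairs k.-1 #|A|))%N.
Proof.
move=> k1 l0 arcA.
pose phi (x : 'Z_N) := srep (l * x - u).
have phi_inj : injective phi.
  by move=> x y /(congr1 (fun z : int => z%:~R : 'Z_N)); rewrite !srepK => /addIr /(mulZI Np l0).
pose B := [fset phi x | x in enum A]%fset.
have cB : #|` B| = #|A|.
  by rewrite card_imfset //= undup_id ?enum_uniq // -cardE.
have phiB x : x \in A -> phi x \in B.
  by move=> xA; apply/imfsetP; exists x; rewrite //= mem_enum.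
have step (x d : 'Z_N) : x \in A -> x + d \in A -> x + d + d \in A ->
    phi (x + d + d) - phi (x + d) = phi (x + d) - phi x.
  move=> /arcA h0 /arcA h1 /arcA h2; apply/eqP; rewrite -subr_eq0; apply/eqP; apply: intrZ_eq0.
    by rewrite -!abs_srep -!/(phi _) in h0 h1 h2; move: (phi _) (phi _) (phi _) h0 h1 h2; lia.
  by rewrite !rmorphB /= !srepK; ring.
rewrite -cB cardE; apply: leq_trans (numAP_int_le B k1).
pose psi (p : 'Z_N * 'Z_N) := (phi p.1, phi (p.1 + p.2) - phi p.1).
apply: (size_le_numAP (psi := psi) k1 (enum_uniq _)).
  move=> p; rewrite mem_enum => /apsP hp.
  have lin i : (i.+1 < k)%N -> phi (p.1 + p.2 *+ i) = phi p.1 + (phi (p.1 + p.2) - phi p.1) *+ i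
      /\ phi (p.1 + p.2 *+ i.+1) - phi (p.1 + p.2 *+ i) = phi (p.1 + p.2) - phi p.1.
    elim: i => [|i IH] ik; first by rewrite mulr1n mulr0n !addr0.
    have [e1 e2] := IH (ltnW ik); split.
      by rewrite [(phi _ - _) *+ _]mulrSr addrA -e1 -e2 addrC subrK.
    have tS j : p.1 + p.2 *+ j.+1 = p.1 + p.2 *+ j + p.2 by rewrite mulrSr addrA.
    by rewrite (tS i.+1) (tS i) step -?(tS i) -?(tS i.+1) ?e2 //; apply: hp; lia.
  move=> i ik; rewrite /psi /=.
  case: i ik => [|i] ik; first by rewrite mulr0n addr0 phiB //; have := hp 0%N ik; rewrite addr0.
  have [e1 e2] := lin i ik.
  by rewrite [(phi _ - _) *+ _]mulrSr addrA -e1 -e2 addrC subrK phiB // hp.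
move=> [a b] [c d] _ _ [] /phi_inj -> /addIr /phi_inj /addrI -> //.
Qed.

End Lift.

Lemma aps_sub_ap3 (G : finZmodType) (k : nat) (A : {set G}) : (2 < k)%N -> aps k A \subset ap3 A.
Proof.
move=> k2; apply/subsetP => p /apsP hp; rewrite inE /mid3 /last3.
have := hp 0%N (ltnW (ltnW k2)); have := hp 1%N (ltnW k2); have := hp 2%N k2.
by rewrite mulr0n addr0 mulr1n mulr2n addrA => -> -> ->.
Qed.

(** If no three consecutive terms are mixed, membership in [X] is constant along the progression. A
    progression contained in neither side is therefore determined by a mixed triple and its
    position, for which there are at most [k] choices. *)
Lemma aps_cut (G : finZmodType) (k : nat) (A X : {set G}) : (2 < k)%N -> X \subset A ->
  (#|aps k A| <= #|aps k X| + #|aps k (A :\: X)| + k * #|mixed3 A X|)%N.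
Proof.
move=> k2 sXA.
pose M := aps k A :\: (aps k X :|: aps k (A :\: X)).
have cM : (#|aps k A| <= #|aps k X :|: aps k (A :\: X)| + #|M|)%N.
  rewrite -(cardsID (aps k X :|: aps k (A :\: X)) (aps k A)) leq_add2r.
  by rewrite subset_leq_card // subsetIr.
apply: leq_trans cM _; apply: leq_add; first exact: (leq_card_setU _ _).1.
pose h (i : nat) (p : G * G) := (p.1 + p.2 *+ i, p.2).
have h_inj i : injective (h i) by move=> [a b] [c d] [] + bd; rewrite bd => e; rewrite (addIr _ e).
have hM p : p \in M -> [exists i : 'I_k, h i p \in mixed3 A X].
  rewrite !inE negb_or => /andP[/andP[nX nXA] /forallP hp].
  have hpA i : (i < k)%N -> p.1 + p.2 *+ i \in A by move=> ik; exact: (hp (Ordinal ik)).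
  apply: contraR nX; rewrite negb_exists => /forallP nmix.
  have same i : (i.+2 < k)%N -> (p.1 + p.2 *+ i \in X) = (p.1 + p.2 *+ i.+1 \in X) /\
       (p.1 + p.2 *+ i.+1 \in X) = (p.1 + p.2 *+ i.+2 \in X).
    move=> ik; have ik0 : (i < k)%N by lia.
    have tS j : p.1 + p.2 *+ j + p.2 = p.1 + p.2 *+ j.+1 by rewrite mulrSr addrA.
    have := nmix (Ordinal ik0); rewrite !inE /mid3 /last3 /= !tS !hpA; [|lia..].
    by rewrite negbK => /andP[/eqP -> /eqP ->].
  have const i : (i < k)%N -> (p.1 + p.2 *+ i \in X) = (p.1 \in X).
    elim: i => [|i IH] ik; first by rewrite mulr0n addr0.
    rewrite -IH; last by lia.
    (* The step to the final term starts no triple; it is read off from the triple that begins one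
       term earlier. *)
    have [lt|ge] := ltnP i.+2 k; first by have [-> _] := same i lt.
    case: i {IH} ik ge => [|i] ik ge; first by lia.
    by have [_ ->] := same i ik.
  apply/forallP => i; rewrite const //; apply: contraR nXA => pX.
  by apply/forallP => j; rewrite inE const // pX hp.
rewrite -sum1_card; apply: (@leq_trans (\sum_(p in M) \sum_(i < k) (h i p \in mixed3 A X)))%N.
  apply: leq_sum => p /hM /existsP[i hi]; rewrite (bigD1 i) //= hi; exact: leq_addr.
rewrite exchange_big /=.
apply: (@leq_trans (\sum_(i < k) #|mixed3 A X|))%N; last by rewrite sum_nat_const card_ord.
apply: leq_sum => i _.
have -> : (\sum_(p in M) (h i p \in mixed3 A X) = #|[set p in M | h i p \in mixed3 A X]|)%N.
  rewrite -sum1dep_card [RHS]big_mkcondr; apply: eq_bigr => p _; by case: (_ \in _).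
rewrite -(card_imset _ (@h_inj i)); apply/subset_leq_card/subsetP => _ /imsetP[p + ->].
by rewrite inE => /andP[].
Qed.

Lemma sqr_le_congruent_pairs (q n : nat) : (0 < q)%N ->
  (n ^ 2 <= 2 * q * size (congruent_pairs q n))%N.
Proof.
move=> q0.
(* The term [q.-1 * n] absorbs the rounding: [q * (n %/ q)] falls short of [n] by at most [q.-1]. *)
have key : (n ^ 2 <= q * size (congruent_pairs q n) + q.-1 * n)%N.
  elim: n => [|n IH]; first by rewrite muln0.
  rewrite size_congruent_pairsS //.
  have := divn_eq n q; have := ltn_pmod n q0; set d := (n %/ q)%N; set r := (n %% q)%N => rq nE.
  move: IH; set S := size _; case: (q) q0 rq nE => // q' _ /=; clear; nia.
have : (n <= size (congruent_pairs q n))%N by rewrite size_congruent_pairsE // leq_addr.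
move: key; set S := size _; nia.
Qed.

(** Induction on [#|A|] with [N] fixed: a counterexample whose smaller subsets obey the bound is
    connected and rich in 3-term progressions, so [rectify] puts a dilate in a short arc, where
    [aps_le_of_arc] refutes it. *)
Lemma aps_prime_le (R : realType) (k : nat) : (2 < k)%N ->
  exists2 c : R, 0 < c & forall (N : nat) (A : {set 'Z_N}), prime N -> #|A|%:R <= c * N%:R ->
    (#|aps k A| <= size (congruent_pairs k.-1 #|A|))%N.
Proof.
move=> k2; have k1 : (1 < k)%N by apply: ltnW.
pose q := k.-1; have q0 : (0 < q)%N by rewrite /q; lia.
have kq : k = q.+1 by rewrite /q; lia.
pose D := (4 * k ^ 2)%N; have D0 : (0 < D)%N by rewrite muln_gt0 expn_gt0 (ltnW k1).
have [c c0 hc] := @rectify R D D0.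
(* For nonempty [A], density at most [3^-1] forces [2 < N], where doubling is injective. *)
exists (Num.min c 3^-1) => [|N A Np]; first by rewrite lt_min c0 invr_gt0 /=.
have N0 : 0 < N%:R :> R by rewrite ltr0n prime_gt0.
have [m] := ubnP #|A|; elim: m A => // m IH A; rewrite ltnS => cA Ac.
set n := #|A| in cA Ac *; rewrite leqNgt; apply/negP => big.
have n0 : (0 < n)%N.
  rewrite lt0n; apply: contraTneq big => n0; rewrite -leqNgt [X in (X <= _)%N](_ : _ = 0)%N //.
  apply: eq_card0 => p; apply/negP => /apsP /(_ 0%N (ltnW k1)).
  by rewrite (cards0_eq n0) inE.
have Ac1 : n%:R <= c * N%:R by apply: le_trans Ac _; rewrite ler_pM2r // ge_min lexx.
have N2 : (2 < N)%N.
  have : n%:R <= 3^-1 * N%:R :> R by apply: le_trans Ac _; rewrite ler_pM2r // ge_min lexx orbT.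
  rewrite ler_pdivlMl // -natrM ler_nat; lia.
have T3 : (n ^ 2 <= D * #|ap3 A|)%N.
  have := sqr_le_congruent_pairs n q0; have := subset_leq_card (aps_sub_ap3 A k2).
  move: big; rewrite -/q /D kq; set S := size _; set t := #|ap3 A|; set T := #|aps _ A|.
  clear; nia.
have conn : connected3 D A.
  move=> X sXA; set n1 := #|X|; set n2 := #|A :\: X|.
  have nE : n = (n1 + n2)%N by rewrite /n -(cardsID X A) (setIidPr sXA).
  have [->|n1_0] := posnP n1; first by [].
  have [->|n2_0] := posnP n2; first by rewrite muln0.
  have sub (Y : {set 'Z_N}) : Y \subset A -> (#|Y| < n)%N -> (#|aps k Y| <= size (congruent_pairs q #|Y|))%N.
    move=> sYA Yn; apply: IH; first exact: leq_trans Yn cA.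
    by apply: le_trans Ac; rewrite ler_nat ltnW.
  have h1 : (#|aps k X| <= size (congruent_pairs q n1))%N by apply: sub => //; rewrite -/n1; lia.
  have h2 : (#|aps k (A :\: X)| <= size (congruent_pairs q n2))%N.
    by apply: sub; [exact: subsetDl | rewrite -/n2; lia].
  have cut := aps_cut k2 sXA.
  have s12 := size_congruent_pairsD q0 n1 n2; have s21 := size_congruent_pairsD q0 n2 n1.
  move: big; rewrite -/q nE; rewrite [(n2 + n1)%N]addnC in s21.
  set M := #|mixed3 A X| in cut *; move=> big.
  (* The induction hypothesis bounds the progressions inside each side of the cut, so the excess
     must come from mixed ones. *)
  have kM : (size (congruent_pairs q (n1 + n2)) < size (congruent_pairs q n1) + size (congruent_pairs q n2) + k * M)%N.
    by apply: leq_trans big _; apply: leq_trans cut _; rewrite leq_add2r leq_add.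
  have b1 := leq_ltn_trans s12 kM; rewrite ltn_add2l in b1.
  rewrite [X in (_ < X + _)%N]addnC in kM.
  have b2 := leq_ltn_trans s21 kM; rewrite ltn_add2l in b2.
  have M0 : (0 < M)%N by case: (M) b1 => // ; rewrite muln0.
  have half x : (q <= x)%N -> (x <= 2 * q * (x %/ q))%N.
    move=> qx; have := divn_eq x q; have := ltn_pmod x q0; have : (0 < x %/ q)%N by rewrite divn_gt0.
    set d := (x %/ q)%N; set r := (x %% q)%N; nia.
  have large x y d : (y <= 2 * q * d)%N -> (2 * (x * d) < k * M)%N -> (x * y <= D * M)%N.
    move=> yd xd; apply: leq_trans (leq_mul (leqnn x) yd) _.
    have -> : (x * (2 * q * d) = q * (2 * (x * d)))%N by ring.
    apply: leq_trans (leq_mul (leqnn q) (ltnW xd)) _.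
    by rewrite mulnA leq_mul2r /D kq; apply/orP; right; clear; nia.
  (* If a side has at least [q] points, its quotient by [q] is comparable to its size and the cross
     term suffices. If neither has, the product is at most [k ^ 2], and one mixed progression is
     enough. *)
  have [q2|q2] := leqP q n2; first exact: large (half _ q2) b1.
  have [q1|q1] := leqP q n1; first by rewrite mulnC; exact: large (half _ q1) b2.
  apply: (@leq_trans (k ^ 2 * 1))%N; last by rewrite leq_mul //; lia.
  by rewrite muln1 -mulnn leq_mul //; lia.
have [l [u [l0 arcA]]] := hc N A Np N2 Ac1 conn T3.
by move: big; rewrite ltnNge (aps_le_of_arc Np k1 l0 arcA).
Qed.

Theorem theorem2p4 (R : realType) (k : nat) (hk : (3 <= k)%N) :
  exists c : R,
    0 < c /\
    (forall (n : nat) (A : {fset int}),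
       (#|` A|)%fset = n -> (numAP k A <= numAP k (zinterval n))%N) /\
    (forall (N n : nat) (A : {fset 'Z_N}),
       prime N -> (#|` A|)%fset = n -> n%:R <= c * N%:R ->
       (numAP k A <= numAP k (zinterval n))%N).
Proof.
have k1 : (1 < k)%N by apply: ltnW.
have [c c0 hc] := aps_prime_le R hk.
exists c; split=> //; split=> [n A <-|N n A Np <- Ac]; rewrite numAP_zinterval //.
  exact: numAP_int_le.
have cA : #|[set x | x \in A]| = #|` A|.
  rewrite cardE -(perm_size (_ : perm_eq (enum_fset A) _)) //.
  apply: uniq_perm; rewrite ?fset_uniq ?enum_uniq // => x.
  by rewrite mem_enum inE.
apply: leq_trans (numAP_le_aps A k1) _; rewrite -cA; apply: hc => //.
by rewrite cA.
Qed.
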